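(* Let $d\ge1$, $\alpha>1$, let $\boldsymbol{\gamma}_d=(\gamma_{d,1},\ldots,\gamma_{d,d})$ satisfy $1\ge\gamma_{d,1}\ge\ldots\ge\gamma_{d,d}>0$, let $1<\tilde\alpha\le\alpha$ and $t\in(0,\frac{\tilde\alpha-1}{2})$. Then there exist $\delta=\delta(\tilde\alpha,t)\in(0,1)$ and $\tau=\tau(\tilde\alpha,t)\in(1/\tilde\alpha,1)\subset(1/\alpha,1)$, which can be chosen as $$\delta(\tilde\alpha,t)=\frac{2+\tilde\alpha}{2}-\sqrt{\Big(\frac{2+\tilde\alpha}{2}\Big)^2-\tilde\alpha+1+2t},\qquad \tau(\tilde\alpha,t)=(\tilde\alpha-\delta(\tilde\alpha,t))^{-1},$$ such that the constant $$c_{\alpha,\tilde\alpha,t,d}:=4\cdot3^{1/\tau-1}\delta^{-\frac{1+\tau}{2\tau}}\sqrt{\frac{\tau}{1-\tau}}\prod_{j=1}^d\left(1+2\zeta(\alpha\tau)\gamma_{d,j}^\tau\right)^{\frac1{2\tau}}$$ satisfies $$c_{\alpha,\tilde\alpha,t,d}<4\cdot3^{\tilde\alpha-1}\delta^{-\frac{\tilde\alpha+1}{2}}\sqrt{\frac{2}{\tilde\alpha-1}}\prod_{j=1}^d\left(1+2\zeta(\alpha\tau)\gamma_{d,j}^\tau\right)^{\frac1{2\tau}}$$ and the following estimate holds: for every $N\ge1$ and every multiple rank-1 lattice $\Lambda=\Lambda(\boldsymbol{z}_1,M_1,\ldots,\boldsymbol{z}_L,M_L)$ such that, with $I=A_d(N)$,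 $I=\bigcup_{\ell=1}^LI_\ell$, $L\le\max(3\ln|A_d(N)|,1)$, $M_1=\ldots=M_L\le3|A_d(N)|$, and $M:=|\Lambda|$ satisfies $2|A_d(N)|<M<9|A_d(N)|\max(\ln|A_d(N)|,1)$, one has $$\sup_{\|f|\mathcal{H}_{\alpha,\boldsymbol{\gamma}_d}(\mathbb{T}^d)\|\le1}\|f-\operatorname{S}_{A_d(N)}^\Lambda f\,|\,L_\infty(\mathbb{T}^d)\|<c_{\alpha,\tilde\alpha,t,d}\,M^{-t}.$$
   Context: $\zeta$ is the Riemann zeta function, $\mathbb{T}\sim[0,1)$, and $c_{\boldsymbol{h}}(f)=\int_{\mathbb{T}^d}f(\boldsymbol{x})\mathrm{e}^{-2\pi\mathrm{i}\boldsymbol{h}\cdot\boldsymbol{x}}\,\mathrm{d}\boldsymbol{x}$. The weight function is $r_d(\alpha,\boldsymbol{\gamma}_d,\boldsymbol{h})=\prod_{j=1}^d\max(1,\gamma_{d,j}^{-1}|h_j|^\alpha)$ for $\boldsymbol{h}\in\mathbb{Z}^d$. The weighted Korobov space $\mathcal{H}_{\alpha,\boldsymbol{\gamma}_d}(\mathbb{T}^d)$ consists of all $f\in L_1(\mathbb{T}^d)$ with $\|f|\mathcal{H}_{\alpha,\boldsymbol{\gamma}_d}(\mathbb{T}^d)\|=\left(\sum_{\boldsymbol{h}\in\mathbb{Z}^d}r_d(\alpha,\boldsymbol{\gamma}_d,\boldsymbol{h})|c_{\boldsymbol{h}}(f)|^2\right)^{1/2}<\infty$; functions are identified with their continuous representatives,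 and point values refer to these. The frequency sets are $A_d(N)=\{\boldsymbol{h}\in\mathbb{Z}^d\colon r_d(\alpha,\boldsymbol{\gamma}_d,\boldsymbol{h})\le N\}$. For $\boldsymbol{z}\in\mathbb{Z}^d$, $M'\in\mathbb{N}$, the rank-1 lattice is $\Lambda(\boldsymbol{z},M')=\{\frac{j}{M'}\boldsymbol{z}\bmod\boldsymbol{1}\colon j=0,\ldots,M'-1\}\subset\mathbb{T}^d$; a multiple rank-1 lattice is $\Lambda(\boldsymbol{z}_1,M_1,\ldots,\boldsymbol{z}_L,M_L)=\bigcup_{\ell=1}^L\Lambda(\boldsymbol{z}_\ell,M_\ell)$ with $L\in\mathbb{N}$, $\boldsymbol{z}_\ell\in\mathbb{Z}^d$, $M_\ell\in\mathbb{N}$. Given a finite $I\subset\mathbb{Z}^d$ and these parameters, define recursively the pairwise disjoint sets $$I_\ell=\Big\{\boldsymbol{h}\in I\setminus\bigcup_{j=1}^{\ell-1}I_j\colon \boldsymbol{h}\cdot\boldsymbol{z}_\ell\not\equiv\boldsymbol{k}\cdot\boldsymbol{z}_\ell\ (\mathrm{mod}\ M_\ell)\text{ for all }\boldsymbol{k}\in I\setminus\{\boldsymbol{h}\}\Big\},\quad\ell=1,\ldots,L,$$ and $$\operatorname{S}_I^\Lambda f(\boldsymbol{x})=\sum_{\ell=1}^L\sum_{\boldsymbol{h}\in I_\ell}\hat f_{\boldsymbol{h}}\,\mathrm{e}^{2\pi\mathrm{i}\boldsymbol{h}\cdot\boldsymbol{x}},\qquad \hat f_{\boldsymbol{h}}=\frac{1}{M_\ell}\sum_{j=0}^{M_\ell-1}f\Big(\frac{j\boldsymbol{z}_\ell}{M_\ell}\Big)\mathrm{e}^{-2\pi\mathrm{i}j\,\boldsymbol{h}\cdot\boldsymbol{z}_\ell/M_\ell}\quad\text{for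 }\boldsymbol{h}\in I_\ell.$$ *)

(* Defs.v *)
From HB Require Import structures.
From mathcomp Require Import all_boot all_order all_algebra finmap.
From mathcomp Require Import complex.
From mathcomp Require Import all_classical all_reals all_analysis.

Set Implicit Arguments.
Unset Strict Implicit.
Unset Printing Implicit Defensive.

Import Order.TTheory GRing.Theory Num.Theory.
Import numFieldNormedType.Exports.

Local Open Scope classical_set_scope.
Local Open Scope ring_scope.
Local Open Scope complex_scope.

(* Dirichlet series; equal to the Riemann zeta function for real s > 1, the
   only arguments at which it is used. *)
Definition zeta (R : realType) (s : R) : R :=
  limn (fun n : nat => \sum_(0 <= k < n) (k.+1%:R `^ (- s))).

Definition cmod (R : realType) (z : R[i]) : R := Normc.normc z.

Definition expi2 (R : realType) (theta : R) : R[i] :=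
  cos (2 * pi * theta) +i* sin (2 * pi * theta).

Definition dotp (R : realType) (d : nat) (h : 'rV[int]_d) (x : 'rV[R]_d) : R :=
  \sum_(i < d) (h ord0 i)%:~R * x ord0 i.

Definition zdotp (d : nat) (h z : 'rV[int]_d) : int :=
  \sum_(i < d) h ord0 i * z ord0 i.

Section TorusMeasure.
Context (R : realType).

Local Notation RR := (measurableTypeR R).

Definition leb01 : set RR -> \bar R :=
  mrestr (@lebesgue_measure R)
    (measurable_itv `[0%R, 1%R[ : measurable (`[0%R, 1%R[%classic : set RR)).

HB.instance Definition _ := Measure.on leb01.

Lemma leb01_setT : leb01 [set: RR] = 1%:E.
Proof.
by rewrite /leb01 /mrestr setTI lebesgue_measure_itv/= lte_fin ltr01 oppr0 adde0.
Qed.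

HB.instance Definition _ := Measure_isProbability.Build _ _ _ leb01 leb01_setT.

Definition tcons (n : nat) (p : RR * n.-tuple RR) : n.+1.-tuple RR :=
  [the n.+1.-tuple RR of p.1 :: p.2].

Lemma measurable_tcons n : measurable_fun [set: RR * n.-tuple RR] (@tcons n).
Proof. exact: measurable_cons. Qed.

HB.instance Definition _ n :=
  isMeasurableFun.Build _ _ _ _ (@tcons n) (@measurable_tcons n).

(* The d-dimensional Lebesgue measure on the cube [0,1)^d, i.e. the d-fold
   product of the Lebesgue measure on [0,1), as a measure on d-tuples. *)
Fixpoint torus_measure (d : nat) : probability (d.-tuple RR) R :=
  match d with
  | 0 => \d_ ([tuple] : 0.-tuple RR)
  | n.+1 => distribution (leb01 \x torus_measure n)%E (@tcons n)
  end.

End TorusMeasure.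

(* The representative in [0,1) of a real modulo 1. *)
Definition frac1 (R : realType) (x : R) : R := x - (Num.floor x)%:~R.

Definition tuple_row (R : realType) (d : nat) (x : d.-tuple (measurableTypeR R)) :
  'rV[R]_d := \row_(i < d) tnth x i.

Section KorobovSpace.
Context (R : realType) (d : nat).

(* A function on the torus is given as a function on R^d of which, for all
   statements up to null sets, only the restriction to [0,1)^d matters.  Point
   values are only taken from continuous representatives (cont_rep). *)
Implicit Types f g : 'rV[R]_d -> R[i].

Local Notation mu := (torus_measure R d).

Definition torus_L1 f : Prop :=
  mu.-integrable [set: d.-tuple (measurableTypeR R)]
    (EFin \o (fun t => complex.Re (f (tuple_row t)))) /\
  mu.-integrable [set: d.-tuple (measurableTypeR R)]
    (EFin \o (fun t => complex.Im (f (tuple_row t)))).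

Definition torus_int f : R[i] :=
  Rintegral mu setT (fun t => complex.Re (f (tuple_row t)))
  +i* Rintegral mu setT (fun t => complex.Im (f (tuple_row t))).

Definition torus_Linfty f : \bar R :=
  Lnorm mu +oo%E (fun t => (cmod (f (tuple_row t)))%:E).

Definition fourier_coef f (h : 'rV[int]_d) : R[i] :=
  torus_int (fun x => f x * expi2 (- dotp h x)).

Definition korobov_weight (alpha : R) (gamma : 'I_d -> R) (h : 'rV[int]_d) : R :=
  \prod_(j < d) Num.max 1 ((gamma j)^-1 * (`|h ord0 j|%:~R `^ alpha)).

Definition korobov_norm (alpha : R) (gamma : 'I_d -> R) f : \bar R :=
  ((\esum_(h in [set: 'rV[int]_d])
      (korobov_weight alpha gamma h * cmod (fourier_coef f h) ^+ 2)%:E)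
   `^ 2^-1)%E.

Definition korobov_space (alpha : R) (gamma : 'I_d -> R) : set ('rV[R]_d -> R[i]) :=
  [set f | torus_L1 f /\ (korobov_norm alpha gamma f < +oo)%E].

(* g is continuous on the torus and agrees with f almost everywhere. *)
Definition is_cont_rep f g : Prop :=
  [/\ continuous (g : 'rV[R]_d -> (R[i])^o),
      forall (x : 'rV[R]_d) (k : 'rV[int]_d), g (x + map_mx intr k) = g x
    & {ae mu, forall t, f (tuple_row t) = g (tuple_row t)}].

(* The continuous representative of f (f itself if there is none). *)
Definition cont_rep f : 'rV[R]_d -> R[i] := xget f [set g | is_cont_rep f g].

(* fset_set sends infinite sets to the empty set; this one is finite when
   gamma > 0 and alpha > 0. *)
Definition korobov_index (alpha : R) (gamma : 'I_d -> R) (N : R) :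
  {fset 'rV[int]_d} :=
  fset_set [set h : 'rV[int]_d | korobov_weight alpha gamma h <= N].

End KorobovSpace.

Section MultipleRank1Lattice.
Context (R : realType) (d : nat).

Definition lattice_point (z : 'rV[int]_d) (M j : nat) : 'rV[R]_d :=
  \row_(i < d) frac1 (j%:R / M%:R * (z ord0 i)%:~R).

Definition rank1_lattice (z : 'rV[int]_d) (M : nat) : set 'rV[R]_d :=
  lattice_point z M @` `I_M.

(* A multiple rank-1 lattice is given by L, z and M; the components
   (z_l, M_l), l = 1, ..., L, are indexed here by l < L, and the values of
   z and M at indices >= L are irrelevant. *)
Definition multiple_lattice (L : nat) (z : nat -> 'rV[int]_d) (M : nat -> nat) :
  set 'rV[R]_d := \bigcup_(l in `I_L) rank1_lattice (z l) (M l).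

(* The h in I \ J that are not aliased on Lambda(z, M) to any other k in I. *)
Definition unaliased (I J : {fset 'rV[int]_d}) (z : 'rV[int]_d) (M : nat) :
  {fset 'rV[int]_d} :=
  [fset h in (I `\` J)%fset |
    all (fun k => (k != h) ==> (zdotp h z != zdotp k z %[mod M%:Z])%Z) I]%fset.

(* The union of the I_j over j < l. *)
Fixpoint level_union (I : {fset 'rV[int]_d}) (z : nat -> 'rV[int]_d)
    (M : nat -> nat) (l : nat) : {fset 'rV[int]_d} :=
  if l is k.+1 then
    let J := level_union I z M k in (J `|` unaliased I J (z k) (M k))%fset
  else fset0.

(* The set I_l. *)
Definition level (I : {fset 'rV[int]_d}) (z : nat -> 'rV[int]_d)
    (M : nat -> nat) (l : nat) : {fset 'rV[int]_d} :=
  unaliased I (level_union I z M l) (z l) (M l).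

Definition lattice_coef (f : 'rV[R]_d -> R[i]) (z : 'rV[int]_d) (M : nat)
    (h : 'rV[int]_d) : R[i] :=
  M%:R^-1 * \sum_(j < M) f (lattice_point z M j)
                         * expi2 (- (j%:R * (zdotp h z)%:~R / M%:R)).

(* S_I^Lambda; its argument f is evaluated pointwise. *)
Definition sampling_op (I : {fset 'rV[int]_d}) (L : nat)
    (z : nat -> 'rV[int]_d) (M : nat -> nat) (f : 'rV[R]_d -> R[i]) :
  'rV[R]_d -> R[i] :=
  fun x => \sum_(l < L) \sum_(h <- level I z M l)
             lattice_coef f (z l) (M l) h * expi2 (dotp h x).

End MultipleRank1Lattice.

Definition delta_const (R : realType) (at_ t : R) : R :=
  (2 + at_) / 2 - Num.sqrt (((2 + at_) / 2) ^+ 2 - at_ + 1 + 2 * t).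

Definition zeta_prod (R : realType) (d : nat) (alpha : R) (gamma : 'I_d -> R)
    (tau : R) : R :=
  \prod_(j < d) (1 + 2 * zeta (alpha * tau) * gamma j `^ tau) `^ (2 * tau)^-1.

Definition c_const (R : realType) (d : nat) (alpha : R) (gamma : 'I_d -> R)
    (delta tau : R) : R :=
  4 * 3 `^ (tau^-1 - 1) * delta `^ (- ((1 + tau) / (2 * tau)))
  * Num.sqrt (tau / (1 - tau)) * zeta_prod alpha gamma tau.

(* Main.v *)
Require Import Defs.
From HB Require Import structures.
From mathcomp Require Import all_boot all_order all_algebra finmap.
From mathcomp Require Import complex.
From mathcomp Require Import all_classical all_reals all_analysis.
From mathcomp Require Import measurable_realfun ess_sup_inf ring lra zify.

(** Let [f] be in the unit ball of the Korobov space, let [c_k] be its Fourier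
    coefficients, [r_k] the weights, [I] the frequency set [A_d(N)] and [n] its
    cardinal, and put [s = 1 / tau = alpha' - delta], so that [1 < s < alpha].

    Reduction to a Fourier series. Since the sum of [1 / r_k] is finite and the sum
    of [r_k |c_k| ^ 2] is at most [1], the coefficients are absolutely summable. The
    Fourier series thus converges uniformly to a continuous periodic function [G]
    ([series_lim]), which has the coefficients of [f]. An integrable function on the
    torus is determined by its Fourier coefficients ([fourier_unique]): if the
    integral of [u] against every exponential vanishes, then so does its integral
    over boxes, whose indicator functions are bounded pointwise limits of
    trigonometric polynomials, hence over all measurable sets. So [f = G] almost
    everywhere, and [G] is the continuous representative of [f] ([cont_repE]).

    Error of the sampling operator. The operator is linear, and on a rank-1 lattice
    an exponential is seen as the ones with congruent frequency. By definition of
    the levels it therefore reproduces the exponentials with frequency in [I]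
    ([sampling_op_exact]), while any other one is mistaken for at most one frequency
    per level ([sampling_op_bound]). The error at any point is thus at most
    [(1 + L)] times the sum of [|c_k|] over [k] outside [I]
    ([sampling_error_bound]), which by the Cauchy-Schwarz inequality is at most the
    square root of the sum of [1 / r_k] over these [k] ([coef_tail]).

    Tail of the weights. Let [P] be the product of the
    [1 + 2 zeta(alpha tau) gamma_j ^ tau], which bounds the sum of all
    [r_k ^ (- tau)] ([weight_sum]). The [m]-th smallest weight is at least
    [(m / P) ^ s], so the tail is at most [P ^ s n ^ (1 - s) / (s - 1)]
    ([weight_tail_sum]).

    Choice of delta. There remains to compare
    [(1 + L) n ^ (- (s - 1) / 2)] with [M ^ (- t)], where [M < 9 n max (ln n) 1] and
    [1 + L <= 4 max (ln n) 1]. The number [delta] is such that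
    [(s - 1) / 2 = t + delta (s + 1) / 2]: the rate [t] is attained with a power of
    [n] to spare, which absorbs the logarithms through [delta ln n <= n ^ delta]
    ([rate_lt]). *)

Set Implicit Arguments.
Unset Strict Implicit.
Unset Printing Implicit Defensive.

Import Order.TTheory GRing.Theory Num.Theory.
Import numFieldNormedType.Exports.

Local Open Scope classical_set_scope.
Local Open Scope ring_scope.

(** * The constants and the choice of delta *)

(** [delta] is the smaller root of [X ^ 2 - (2 + a) X + (a - 1 - 2 t)], which is
    the last identity. This polynomial is positive at [0] and negative at [1] and
    at [(a - 1) / 2], whence the bounds. *)
Lemma delta_constP (R : realType) (a t : R) : 1 < a -> 0 < t < (a - 1) / 2 ->
  let d := delta_const a t in
  [/\ 0 < d < 1, 2 * d < a - 1
    & 2 * t = (1 - d) * (a - d + 1) - 2].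
Proof.
move=> a1 /andP[t0 ta]; rewrite /delta_const.
set D := (_ - a + 1 + 2 * t) : R.
have D_gt : (3 / 2) ^+ 2 < D by rewrite /D; nra.
have sD : Num.sqrt D ^+ 2 = D by rewrite sqr_sqrtr// ltW// (lt_trans _ D_gt)//; lra.
have sP : 0 <= Num.sqrt D by exact: sqrtr_ge0.
have sg : 3 / 2 < Num.sqrt D by rewrite -ltr_sqr ?nnegrE ?sD//; lra.
move: sD sP sg; set s := Num.sqrt D => sD sP sg /=.
have sl : s < (2 + a) / 2.
  by rewrite -ltr_sqr ?nnegrE ?sD//; [rewrite /D|]; lra.
have sa : a / 2 < s.
  by rewrite -ltr_sqr ?nnegrE ?sD//; [rewrite /D|]; nra.
split; [by apply/andP; split; lra | lra | move: sD; rewrite /D; nra].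
Qed.

(** Each factor grows; for the square roots this is [2 e < a - 1]. *)
Lemma c_const_lt (R : realType) (d : nat) (alpha : R) (gamma : 'I_d -> R)
    (a e : R) : 1 < a -> 0 < e < 1 -> 2 * e < a - 1 ->
  0 < zeta_prod alpha gamma (a - e)^-1 ->
  c_const alpha gamma e (a - e)^-1 <
    4 * 3 `^ (a - 1) * e `^ (- ((a + 1) / 2))
    * Num.sqrt (2 / (a - 1)) * zeta_prod alpha gamma (a - e)^-1.
Proof.
move=> a1 /andP[e0 e1] ea z0; rewrite /c_const ltr_pM2r//.
have s0 : a - e != 0 by lra.
have s1 : a - e - 1 != 0 by lra.
have a10 : a - 1 != 0 by lra.
rewrite invrK.
have -> : (1 + (a - e)^-1) / (2 * (a - e)^-1) = (a - e + 1) / 2.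
  by field; rewrite s0.
have -> : (a - e)^-1 / (1 - (a - e)^-1) = (a - e - 1)^-1.
  by field; rewrite s0 s1.
apply: ltr_pM; rewrite ?mulr_ge0 ?powR_ge0 ?sqrtr_ge0 ?ler0n//.
  rewrite -!mulrA ltr_pM2l// ; apply: ltr_pM; rewrite ?powR_ge0//.
    by rewrite /powR gt_eqF// ltr_expR ltr_pM2r ?ln_gt0 ?ltr1n//; lra.
  rewrite !powRN ltf_pV2 ?posrE ?powR_gt0//.
  by rewrite /powR gt_eqF// ltr_expR ltr_nM2r ?ln_lt0 ?e0//; lra.
rewrite ltr_sqrt; last by rewrite divr_gt0//; lra.
rewrite -[X in X < _]div1r ltr_pdivrMr; last by lra.
by rewrite mulrAC ltr_pdivlMr; lra.
Qed.

(** This absorbs the logarithms: [e ln n <= n ^ e] because [x <= exp x], and the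
    exponent [1 - e] only decreases [ln n] once it is at least [1]. *)
Lemma max_ln_powR (R : realType) (n e : R) : 1 <= n -> 0 < e < 1 ->
  (Num.max (ln n) 1) `^ (1 - e) * n `^ (- e) <= e^-1.
Proof.
move=> n1 /andP[e0 e1].
have n0 : 0 < n by exact: lt_le_trans n1.
have ei : 1 <= e^-1 by rewrite invf_ge1// ltW.
have [l1|l1] := leP (ln n) 1.
  rewrite powR1 mul1r powRN (le_trans _ ei)// invf_le1 ?powR_gt0//.
  by rewrite -[X in X <= _](powRr0 n) ler_powR// ltW.
have h1 : ln n `^ (1 - e) <= ln n.
  by rewrite ler1_powR//; lra.
apply: (le_trans (ler_wpM2r (powR_ge0 _ _) h1)).
rewrite powRN ler_pdivrMr ?powR_gt0// mulrC ler_pdivlMr//.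
rewrite /powR gt_eqF// mulrC; apply: le_trans (expR_ge1Dx _); lra.
Qed.

(** By the choice of [e] the exponents balance: [1 + t = (1 - e) (s + 1) / 2] and
    [(s - 1) / 2 = t + e (s + 1) / 2]. With
    [m = max (ln n) 1], what remains after dividing by [(n m) ^ (- t)] is the power [(s + 1) / 2] of [max_ln_powR]; the constant [9 ^ t] is paid for
    by [3 ^ (s - 1)], as [2 t <= s - 1]. *)
Lemma rate_lt (R : realType) (n M L a t e s : R) :
  e = delta_const a t -> s = a - e ->
  1 < a -> 0 < t < (a - 1) / 2 -> 1 <= n -> 0 < M ->
  M < 9 * n * Num.max (ln n) 1 -> L <= Num.max (3 * ln n) 1 ->
  (1 + L) * n `^ (- ((s - 1) / 2)) <
  4 * 3 `^ (s - 1) * e `^ (- ((1 + s) / 2)) * M `^ (- t).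
Proof.
move=> eE sE a1 t01 n1 M0 Mlt Lle.
have [e01 ea et] := delta_constP a1 t01; rewrite -eE in e01 ea et.
have [t0 ta] := andP t01; have [e0 e1] := andP e01.
have n0 : 0 < n by exact: lt_le_trans n1.
have Hm := max_ln_powR n1 e01.
set m := Num.max (ln n) 1 in Mlt Hm.
have m1 : 1 <= m by rewrite /m le_max lexx orbT.
have m0 : 0 < m by exact: lt_le_trans m1.
have L4 : 1 + L <= 4 * m.
  have lm : ln n <= m by rewrite /m le_max lexx.
  have : Num.max (3 * ln n) 1 <= 3 * m by rewrite ge_max; apply/andP; split; lra.
  lra.
have s1 : 1 < s by lra.
have B0 : 0 < 9 * n * m by rewrite !mulr_gt0.
apply: (@le_lt_trans _ _ (4 * 3 `^ (s - 1) * e `^ (- ((1 + s) / 2)) *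
   (9 * n * m) `^ (- t))); last first.
  rewrite ltr_pM2l ?mulr_gt0 ?powR_gt0//.
  by rewrite !powRN ltf_pV2 ?posrE ?powR_gt0// gt0_ltr_powR// nnegrE ltW.
have n9 : 0 <= 9 * n by rewrite mulr_ge0// ltW.
rewrite (powRM _ n9 (ltW m0)) (powRM _ (ler0n _ 9) (ltW n0)).
have h3 : 1 <= 3 `^ (s - 1) * 9 `^ (- t).
  have -> : 9 = 3 `^ 2 :> R by rewrite powR_mulrn//; lra.
  rewrite -powRrM -powRD ?pnatr_eq0 ?implybT//.
  by rewrite -[X in X <= _](powRr0 3) ler_powR ?ler1n//; nra.
set q := (1 + s) / 2.
have q0 : 0 < q by rewrite /q; lra.
have -> : n `^ (- ((s - 1) / 2)) = n `^ (- t) * (n `^ (- e)) `^ q.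
  rewrite -powRrM -powRD ?(gt_eqF n0) ?implybT//; congr (_ `^ _).
  by rewrite /q; nra.
have key : m * (n `^ (- e)) `^ q <= e `^ (- q) * m `^ (- t).
  have mE : m = m `^ (- t) * (m `^ (1 - e)) `^ q.
    rewrite -powRrM -powRD ?(gt_eqF m0) ?implybT//.
    by rewrite -[LHS]powRr1 ?ltW//; congr (_ `^ _); rewrite /q; nra.
  rewrite [X in X * _ <= _]mE -mulrA -powRM ?powR_ge0// mulrC ler_wpM2r ?powR_ge0//.
  have -> : e `^ (- q) = (e^-1) `^ q.
    by rewrite -powR_inv1 ?ltW// -powRrM mulN1r.
  apply: (ge0_ler_powR (ltW q0)) => //; rewrite nnegrE ?invr_ge0 ?(ltW e0)//.
  by rewrite mulr_ge0 ?powR_ge0.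
set A := n `^ (- t); set B := (n `^ (- e)) `^ q; set E := e `^ (- q).
set T := m `^ (- t); set X := 3 `^ (s - 1) in h3 *; set Y := 9 `^ (- t) in h3 *.
have A0 : 0 <= A := powR_ge0 _ _.
have B0' : 0 <= B := powR_ge0 _ _.
have ET0 : 0 <= E * T by rewrite mulr_ge0 ?powR_ge0.
apply: (@le_trans _ _ (4 * A * (m * B))).
  have := ler_wpM2r (mulr_ge0 A0 B0') L4; nra.
apply: (@le_trans _ _ (4 * A * (E * T))).
  by rewrite ler_wpM2l// mulr_ge0.
have := ler_wpM2l (mulr_ge0 A0 ET0) h3; nra.
Qed.

(** * Sums over the weight function *)

(** The comparison of [x ^ (- s)] with its integral over the interval
    from [m] to [m + 1], obtained from [ln (1 - x) <= - x] and [1 + x <= exp x]. *)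
Lemma powR_decr_step (R : realType) (s m : R) : 1 < s -> 0 < m ->
  (m + 1) `^ (- s) <= (m `^ (1 - s) - (m + 1) `^ (1 - s)) / (s - 1).
Proof.
move=> s1 m0.
have m10 : 0 < m + 1 by lra.
rewrite ler_pdivlMr; last lra.
have -> : (m + 1) `^ (- s) = (m + 1) `^ (1 - s) / (m + 1).
  rewrite -[X in _ = _ / X]powRr1 ?ltW// -powRB ?(gt_eqF m10) ?implybT//.
  by congr (_ `^ _); lra.
have -> : m `^ (1 - s) = (m + 1) `^ (1 - s) * (m / (m + 1)) `^ (1 - s).
  by rewrite -powRM ?mulr_ge0 ?invr_ge0 ?ltW//; congr (_ `^ _); field; lra.
set P := (m + 1) `^ (1 - s).
have -> : P * (m / (m + 1)) `^ (1 - s) - P = P * ((m / (m + 1)) `^ (1 - s) - 1).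
  by rewrite mulrBr mulr1.
rewrite -mulrA ler_wpM2l ?powR_ge0//.
have q0 : 0 < m / (m + 1) by rewrite divr_gt0.
rewrite /powR gt_eqF//.
have hl : ln (m / (m + 1)) <= - (m + 1)^-1.
  have -> : m / (m + 1) = 1 + - (m + 1)^-1 by field; lra.
  by apply: le_ln1Dx; rewrite ltrN2 invf_lt1//; lra.
rewrite lerBrDr; apply: le_trans (expR_ge1Dx _).
rewrite addrC lerD2l; nra.
Qed.

Lemma sum_powR_le (R : realType) (s : R) (n j : nat) : 1 < s -> (0 < n)%N ->
  \sum_(i < j) ((n + i).+1%:R : R) `^ (- s) <=
    (n%:R `^ (1 - s) - (n + j)%:R `^ (1 - s)) / (s - 1).
Proof.
move=> s1 n0; elim: j => [|j IH]; first by rewrite big_ord0 addn0 subrr mul0r.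
rewrite big_ord_recr/=.
have := @powR_decr_step _ s (n + j)%:R s1.
rewrite ltr0n addn_gt0 n0/= natr1 => /(_ isT) h.
apply: le_trans (lerD IH h) _.
by rewrite addnS -mulrDl; apply: ler_wpM2r; [rewrite invr_ge0|]; lra.
Qed.

Lemma sum_powR_tail (R : realType) (s : R) (n j : nat) : 1 < s -> (0 < n)%N ->
  \sum_(i < j) ((n + i).+1%:R : R) `^ (- s) <= n%:R `^ (1 - s) / (s - 1).
Proof.
move=> s1 n0; apply: le_trans (sum_powR_le _ s1 n0) _.
apply: ler_wpM2r; first by rewrite invr_ge0; lra.
by rewrite lerBlDr lerDl powR_ge0.
Qed.

Lemma zeta_ge (R : realType) (s : R) (n : nat) : 1 < s ->
  \sum_(0 <= k < n) (k.+1%:R `^ (- s)) <= zeta s.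
Proof.
move=> s1; rewrite /zeta.
have nd : nondecreasing_seq (fun n : nat => \sum_(0 <= k < n) ((k.+1%:R : R) `^ (- s))).
  apply/nondecreasing_seqP => k; rewrite [leRHS]big_nat_recr//= lerDl.
  exact: powR_ge0.
apply: (nondecreasing_cvgn_le nd).
apply: nondecreasing_is_cvgn => //.
exists (1 + 1 / (s - 1)) => _ [k _ <-].
case: k => [|k].
  by rewrite big_geq// addr_ge0// divr_ge0//; lra.
rewrite big_mkord big_ord_recl/= powR1 lerD2l.
by have := @sum_powR_tail _ s 1 k s1 isT; rewrite powR1; apply.
Qed.

Lemma zeta_ge0 (R : realType) (s : R) : 1 < s -> 0 <= zeta s.
Proof. by move=> s1; have := zeta_ge 0 s1; rewrite big_geq. Qed.

(** In increasing order of weight, the [m]-th weight is at least [(m / C) ^ s]: the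
    first [m] terms of the sum of [w ^ (- 1 / s)] amount to at most [C], and none
    of them is smaller than the [m]-th. The elements of [J] come after the
    [#|` I|] elements of [I], so the sum is bounded by a tail of the series of
    [m ^ (- s)]. Sorting is avoided by removing a heaviest element of [J] at each
    step of the induction. *)
Lemma weight_tail_sum (R : realType) (K : choiceType) (w : K -> R) (I : {fset K})
    (N C s : R) :
  1 < s -> (forall k, 0 < w k) -> {in I, forall k, w k <= N} ->
  (forall F : {fset K}, \sum_(k <- F) w k `^ (- s^-1) <= C) ->
  (0 < #|` I|)%N ->
  forall J : {fset K}, {in J, forall k, N < w k} ->
  \sum_(k <- J) (w k)^-1 <= C `^ s * ((#|` I|)%:R `^ (1 - s) / (s - 1)).
Proof.
move=> s1 w0 wI wC I0 J wJ.
have s0 : 0 < s by lra.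
have C0 : 0 <= C by have := wC fset0; rewrite big_nil.
suff H : \sum_(k <- J) (w k)^-1 <=
    C `^ s * \sum_(i < #|` J|) ((#|` I| + i).+1%:R : R) `^ (- s).
  by apply: le_trans H _; rewrite ler_wpM2l ?powR_ge0// sum_powR_tail.
move: {2}(#|` J|) (erefl #|` J|) wJ => n.
elim: n J => [|n IH] J Jn wJ.
  by rewrite (cardfs0_eq Jn) big_seq_fset0 cardfs0 big_ord0 mulr0.
have [k kJ kmax] : exists2 k, k \in J & {in J, forall j, w j <= w k}.
  have /fset0Pn [j0 j0J] : J != fset0 by rewrite -cardfs_gt0 Jn.
  have [k _ kmax] := @arg_maxP _ _ _ [` j0J]%fset predT (fun j : J => w (val j)) isT.
  exists (val k); first exact: valP.
  by move=> j jJ; exact: (kmax [` jJ]%fset isT).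
have Jk : #|` (J `\ k)%fset| = n by have := cardfsD1 k J; rewrite kJ Jn => -[].
have {}IH := IH _ Jk _.
rewrite (big_fsetD1 k)//= Jn big_ord_recr/= mulrDr addrC.
have {}IH := IH (fun j jJ => wJ j (fsubsetP (fsubD1set J k) j jJ)).
rewrite Jk in IH; apply: lerD => //.
have dis : [disjoint I & J]%fset.
  apply/fdisjointP => x xI; apply/negP => xJ.
  by have := le_lt_trans (wI _ xI) (wJ _ xJ); rewrite ltxx.
have m0 : 0 < ((#|` I| + n).+1%:R : R) by rewrite ltr0n.
have wkm : (#|` I| + n).+1%:R * w k `^ (- s^-1) <= C.
  apply: le_trans (wC (I `|` J)%fset).
  have <- : #|` (I `|` J)%fset| = (#|` I| + n).+1.
    by apply/eqP; rewrite -(eqn_add2r #|` (I `&` J)%fset|) cardfsUI Jn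
      (disjoint_fsetI0 dis) cardfs0 addn0 addnS.
  rewrite mulr_natl -(iter_addr_0 _ _) -(count_predT (enum_fset (I `|` J)%fset)) -big_const_seq.
  rewrite !big_seq; apply: ler_sum => h; rewrite in_fsetU => hIJ.
  rewrite !powRN lef_pV2 ?posrE ?powR_gt0//.
  apply: ge0_ler_powR; rewrite ?nnegrE ?invr_ge0 ?(ltW (w0 _)) ?(ltW s0)//.
  by case/orP: hIJ => [/wI h1|/kmax//]; rewrite (le_trans h1)// ltW// wJ.
have -> : (w k)^-1 = (w k `^ (- s^-1)) `^ s.
  by rewrite -powRrM mulNr mulVf ?gt_eqF// powR_inv1// ltW.
have -> : (#|` I| + n).+1%:R `^ (- s) = (#|` I| + n).+1%:R^-1 `^ s :> R.
  by rewrite -powR_inv1 ?ler0n// -powRrM mulN1r.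
rewrite -powRM ?invr_ge0 ?ler0n//.
apply: (ge0_ler_powR (ltW s0)); rewrite ?nnegrE ?powR_ge0 ?mulr_ge0 ?invr_ge0 ?ler0n//.
by rewrite ler_pdivlMr// mulrC.
Qed.

Lemma ler_sum_subseq (R : realType) (T : eqType) (r1 r2 : seq T) (f : T -> R) :
  uniq r1 -> {subset r1 <= r2} -> (forall x, 0 <= f x) ->
  \sum_(x <- r1) f x <= \sum_(x <- r2) f x.
Proof.
move=> u1 sub f0; elim: r1 r2 u1 sub => [|a r1 IH] r2.
  by move=> _ _; rewrite big_nil sumr_ge0.
move=> /= /andP[ar1 u1] sub.
have ar2 : a \in r2 by apply: sub; rewrite mem_head.
rewrite big_cons (perm_big _ (perm_to_rem ar2)) big_cons lerD2l.
apply: IH => // x xr1.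
have : x \in a :: rem a r2.
  by rewrite -(perm_mem (perm_to_rem ar2)) sub// in_cons xr1 orbT.
by rewrite in_cons => /orP[/eqP xa|//]; rewrite -xa xr1 in ar1.
Qed.

Lemma powR_prod (R : realType) (T : finType) (u : T -> R) (p : R) :
  (forall j, 0 <= u j) -> (\prod_j u j) `^ p = \prod_j u j `^ p.
Proof.
move=> u0; pose P (x y : R) := 0 <= x /\ x `^ p = y.
suff [] : P (\prod_j u j) (\prod_j u j `^ p) by [].
elim/big_ind2: _ => [|x1 x2 y1 y2 [x0 <-] [y0 <-]|j _]; split => //.
- by rewrite powR1.
- exact: mulr_ge0.
- by rewrite powRM.
Qed.

Section Weight.
Variables (R : realType) (d : nat) (alpha : R) (gamma : 'I_d -> R).
Hypothesis gamma_le1 : forall j, gamma j <= 1.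
Hypothesis gamma_gt0 : forall j, 0 < gamma j.
Hypothesis alpha_gt1 : 1 < alpha.

Definition weight_factor (g : R) (k : int) : R := Num.max 1 (g^-1 * (`|k|%:~R `^ alpha)).

Lemma weight_factor_ge1 g k : 1 <= weight_factor g k.
Proof. by rewrite le_max lexx. Qed.

Lemma weight_ge1 h : 1 <= korobov_weight alpha gamma h.
Proof.
rewrite /korobov_weight; elim/big_ind: _ => // [x y x1 y1|j _].
  by rewrite mulr_ege1.
exact: weight_factor_ge1.
Qed.

Lemma weight_gt0 h : 0 < korobov_weight alpha gamma h.
Proof. exact: lt_le_trans (weight_ge1 h). Qed.

Lemma weight0 : korobov_weight alpha gamma 0 = 1.
Proof.
rewrite /korobov_weight big1// => j _.
by rewrite mxE normr0 powR0 ?gt_eqF// ?mulr0 ?max_l// (lt_trans _ alpha_gt1).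
Qed.

(** Every other factor of the weight is at least [1]. *)
Lemma weight_coord_le h N j : korobov_weight alpha gamma h <= N ->
  `|h ord0 j|%:~R <= N.
Proof.
move=> hN.
have h1 : weight_factor (gamma j) (h ord0 j) <= N.
  apply: le_trans hN; rewrite /korobov_weight (bigD1 j)//= ler_peMr//.
    by rewrite (le_trans _ (weight_factor_ge1 _ _)).
  by elim/big_ind: _ => // [x y x1 y1|i _]; [rewrite mulr_ege1|exact: weight_factor_ge1].
have [->|h0] := eqVneq (h ord0 j) 0.
  by rewrite normr0 (le_trans _ h1)// (le_trans _ (weight_factor_ge1 _ _)).
apply: le_trans h1; rewrite le_max; apply/orP; right.
have a1 : 1 <= `|h ord0 j|%:~R :> R.
  by rewrite -[1]/(1%:~R) ler_int; rewrite -gtz0_ge1 normr_gt0.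
rewrite -[leLHS]mul1r; apply: ler_pM => //.
  by rewrite invf_ge1.
by rewrite -[leLHS]powRr1 ?(le_trans _ a1)// ler_powR// ltW.
Qed.

(** The integer points with coordinates between [- m] and [m], indexed by a finite
    type of functions so that sums of products over the box factorize. *)
Definition box_point (m : nat) (f : {ffun 'I_d -> 'I_(m + m).+1}) : 'rV[int]_d :=
  \row_j ((f j : nat)%:Z - m%:Z).

Lemma box_pointP (m : nat) (h : 'rV[int]_d) :
  (forall j, `|h ord0 j| <= m%:Z) -> exists f, h = @box_point m f.
Proof.
move=> hm.
exists [ffun j => inord (absz (h ord0 j + m%:Z))].
apply/rowP => j; have := hm j; rewrite mxE ffunE ler_norml => /andP[].
by move: (h ord0 j) => k k1 k2; rewrite inordK; lia.
Qed.

Lemma finite_weight_le (N : R) :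
  finite_set [set h : 'rV[int]_d | korobov_weight alpha gamma h <= N].
Proof.
apply: (@sub_finite_set _ _ (range (@box_point (absz (Num.ceil N))))); last first.
  exact: finite_image.
move=> h /= hN; have [|f ->] := @box_pointP (absz (Num.ceil N)) h; last by exists f.
move=> j; have := weight_coord_le j hN => hj.
have : `|h ord0 j| <= Num.ceil N.
  by rewrite -(ler_int R) (le_trans hj)// ceil_ge.
by rewrite abszE => /le_trans; apply; exact: ler_norm.
Qed.

Lemma mem_korobov_index N h :
  (h \in korobov_index alpha gamma N) = (korobov_weight alpha gamma h <= N).
Proof.
rewrite /korobov_index in_fset_set; last exact: finite_weight_le.
by apply/idP/idP => [/set_mem//|hN]; apply/mem_set.
Qed.

(** As [g <= 1], the maximum in the weight is its second argument except at
    frequency [0]; each [k > 0] is then counted twice, for [k] and [- k]. *)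
Lemma weight_factor_sum (tau g : R) (m : nat) : 0 < tau -> 1 < alpha * tau -> 0 < g <= 1 ->
  \sum_(i < (m + m).+1) weight_factor g ((i : nat)%:Z - m%:Z) `^ (- tau) <=
  1 + 2 * zeta (alpha * tau) * g `^ tau.
Proof.
move=> tau0 at1 /andP[g0 g1].
have W0 : weight_factor g 0 `^ (- tau) = 1.
  rewrite /weight_factor normr0 powR0 ?mulr0 ?max_l// ?powR1//.
  by rewrite gt_eqF// (lt_trans _ alpha_gt1).
have WS (k : nat) : weight_factor g k.+1%:Z `^ (- tau) = g `^ tau * k.+1%:R `^ (- (alpha * tau)).
  have k1 : 1 <= k.+1%:R `^ alpha :> R.
    by rewrite -[X in X <= _](powRr0 k.+1%:R) ler_powR ?ler1n ?ltW// (lt_trans _ alpha_gt1).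
  rewrite /weight_factor max_r; last by rewrite mulr_ege1 ?invf_ge1.
  rewrite powRM ?invr_ge0 ?powR_ge0 ?ltW//; congr (_ * _).
    by rewrite -powR_inv1 ?ltW// -powRrM mulrNN mul1r.
  by rewrite -powRrM mulrN.
have WN k : weight_factor g (- k) = weight_factor g k by rewrite /weight_factor normrN.
rewrite -(big_mkord xpredT (fun i => weight_factor g (i%:Z - m%:Z) `^ (- tau))).
rewrite (@big_cat_nat _ _ _ m)//=; last by lia.
rewrite [X in _ + X]big_nat_recl//=; last lia.
rewrite subrr W0.
have S1 : \sum_(m <= i < m + m) weight_factor g (i.+1%:Z - m%:Z) `^ (- tau) =
   \sum_(0 <= k < m) g `^ tau * k.+1%:R `^ (- (alpha * tau)).
  rewrite -{1}(add0n m) big_addn addnK; apply: eq_bigr => i _; rewrite -WS.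
  by congr (weight_factor _ _ `^ _); lia.
have S2 : \sum_(0 <= i < m) weight_factor g (i%:Z - m%:Z) `^ (- tau) =
   \sum_(0 <= k < m) g `^ tau * k.+1%:R `^ (- (alpha * tau)).
  rewrite big_nat_rev/= add0n; apply: eq_big_nat => i /andP[_ im]; rewrite -WS -WN.
  by congr (weight_factor _ _ `^ _); lia.
rewrite S1 S2 -mulr_sumr addrCA lerD2l.
have h := ler_wpM2l (powR_ge0 g tau) (zeta_ge m at1).
by rewrite -mulrA [X in _ <= 2 * X]mulrC mulr_natl mulr2n lerD.
Qed.

(** On a box the sum of the product weight is the product over the coordinates of
    one-dimensional sums. *)
Lemma weight_sum (tau : R) (F : {fset 'rV[int]_d}) : 0 < tau -> 1 < alpha * tau ->
  \sum_(h <- F) korobov_weight alpha gamma h `^ (- tau) <=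
  \prod_(j < d) (1 + 2 * zeta (alpha * tau) * gamma j `^ tau).
Proof.
move=> tau0 at1.
have [m Fm] : exists m : nat, forall h : 'rV[int]_d, h \in F ->
      forall j, `|h ord0 j| <= m%:Z.
  exists (\max_(h <- F) \max_(j < d) absz (h ord0 j))%N => h hF j.
  rewrite -abszE lez_nat.
  apply: (leq_trans (@leq_bigmax _ (fun j : 'I_d => absz (h ord0 j)) j)).
  by have := @leq_bigmax_seq _ (enum_fset F) xpredT
      (fun h : 'rV[int]_d => \max_(j < d) absz (h ord0 j))%N h hF isT.
pose G (j : 'I_d) (i : 'I_(m + m).+1) := weight_factor (gamma j) ((i : nat)%:Z - m%:Z) `^ (- tau).
apply: (@le_trans _ _ (\prod_(j < d) \sum_(i < (m + m).+1) G j i)); last first.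
  apply: ler_prod => j _; apply/andP; split.
    by apply: sumr_ge0 => i _; exact: powR_ge0.
  by apply: weight_factor_sum => //; rewrite gamma_gt0 gamma_le1.
rewrite bigA_distr_bigA/=.
have -> : \sum_(f : {ffun 'I_d -> 'I_(m + m).+1}) \prod_j G j (f j) =
    \sum_(h <- [seq box_point f | f <- enum {: {ffun 'I_d -> 'I_(m + m).+1}}])
     korobov_weight alpha gamma h `^ (- tau).
  rewrite big_map enumT; apply: eq_bigr => f _.
  rewrite /korobov_weight powR_prod; last by move=> j; rewrite le_max ler01.
  by apply: eq_bigr => j _; rewrite /G mxE.
apply: ler_sum_subseq; [exact: fset_uniq| |by move=> x; exact: powR_ge0].
move=> h hF; have [f ->] := box_pointP (Fm _ hF).
by apply: map_f; rewrite mem_enum.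
Qed.

End Weight.

(** * Trigonometric integrals on the torus *)

Section Trig.
Context {R : realType}.
Local Notation RR := (measurableTypeR R).

Definition cos2 (x : R) : R := cos (2 * pi * x).
Definition sin2 (x : R) : R := sin (2 * pi * x).

Lemma cos2D x y : cos2 (x + y) = cos2 x * cos2 y - sin2 x * sin2 y.
Proof. by rewrite /cos2 mulrDr cosD. Qed.

Lemma sin2D x y : sin2 (x + y) = sin2 x * cos2 y + cos2 x * sin2 y.
Proof. by rewrite /sin2 mulrDr sinD. Qed.

Lemma cos2N x : cos2 (- x) = cos2 x.
Proof. by rewrite /cos2 mulrN cosN. Qed.

Lemma sin2N x : sin2 (- x) = - sin2 x.
Proof. by rewrite /sin2 mulrN sinN. Qed.

Lemma sin2E x : sin2 x = cos2 (x - 4^-1).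
Proof.
rewrite /sin2 /cos2 -cosBpihalf; congr cos; lra.
Qed.

Lemma cos2_int (k : int) : cos2 k%:~R = 1 /\ sin2 k%:~R = 0.
Proof.
have nat_case (n : nat) : cos2 n%:R = 1 /\ sin2 n%:R = 0.
  rewrite /cos2 /sin2.
  have -> : 2 * pi * n%:R = 0 + (pi *+ 2) *+ n :> R by rewrite add0r -[RHS]mulr_natr -(mulr_natl pi).
  rewrite (periodicn (@cosD2pi R)) (periodicn (@sinD2pi R)).
  by rewrite cos0 sin0.
case: k => n; first exact: nat_case.
rewrite NegzE mulrNz cos2N sin2N; have [-> ->] := nat_case n.+1.
by rewrite oppr0.
Qed.

Lemma sin2Dint x (k : int) : sin2 (x + k%:~R) = sin2 x.
Proof. by rewrite sin2D; have [-> ->] := cos2_int k; rewrite mulr1 mulr0 addr0. Qed.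

Lemma continuous_cos2 : continuous cos2.
Proof.
move=> x; apply: continuous_comp; last exact: continuous_cos.
by apply: continuousM; [exact: cvg_cst|exact: cvg_id].
Qed.

Lemma continuous_sin2 : continuous sin2.
Proof.
move=> x; apply: continuous_comp; last exact: continuous_sin.
by apply: continuousM; [exact: cvg_cst|exact: cvg_id].
Qed.

Lemma measurable_cos2 : measurable_fun [set: RR] (cos2 : RR -> RR).
Proof. exact: continuous_measurable_fun continuous_cos2. Qed.

Lemma integrable_cos2 d (T : measurableType d) (P : probability T R) (f : T -> RR) :
  measurable_fun setT f -> P.-integrable setT (fun t => (cos2 (f t))%:E).
Proof.
move=> mf; apply: (@measurable_bounded_integrable _ _ _ P (cos2 \o f)) => //.
- by rewrite -ge0_fin_numE// fin_num_measure.
- exact: measurableT_comp measurable_cos2 mf.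
- by exists 1; split => // M M1 x _ /=; rewrite (le_trans (cos_max _))// ltW.
Qed.

Lemma integral_leb01 (f : RR -> R) :
  (@leb01 R).-integrable setT (EFin \o f) ->
  (\int[@leb01 R]_x (f x)%:E = \int[lebesgue_measure]_(x in `[0%R, 1%R[) (f x)%:E)%E.
Proof.
move=> fi.
have mI : measurable (`[0%R, 1%R[%classic : set RR) by exact: measurable_itv.
rewrite (@negligible_integral _ _ _ _ _ (~` (`[0%R, 1%R[%classic : set RR)))//; last 2 first.
- exact: measurableC.
- by rewrite /= /leb01 /mrestr setICl measure0.
rewrite setTD setCK; apply: eq_measure_integral => A mA AI.
by rewrite /= /leb01 /mrestr setIidl.
Qed.

Lemma integral_cos2_1d (a : R) (k : int) :
  (\int[@leb01 R]_x (cos2 (a + k%:~R * x))%:E = (if k == 0 then cos2 a else 0)%:E)%E.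
Proof.
have mf : measurable_fun setT (fun x : RR => a + k%:~R * x : RR).
  by apply: measurable_funD => //; apply: measurable_funM.
have [->|k0] := eqVneq k 0.
  under eq_integral do rewrite mul0r addr0.
  by rewrite integral_cst//= leb01_setT mule1.
rewrite integral_leb01; last exact: integrable_cos2.
rewrite integral_itv_bndo_bndc; last first.
  apply/measurable_EFinP; apply: measurable_funTS.
  exact: measurableT_comp measurable_cos2 mf.
have c0 : 2 * pi * k%:~R != 0 :> R.
  by rewrite !mulf_eq0 !negb_or pnatr_eq0 intr_eq0 k0 (gt_eqF (pi_gt0 _)).
pose F x := (2 * pi * k%:~R)^-1 * sin2 (a + k%:~R * x).
have dF (x : R) : is_derive x 1 F (cos2 (a + k%:~R * x)).
  have -> : cos2 (a + k%:~R * x) =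
     (2 * pi * k%:~R)^-1 *: ((2 * pi * k%:~R) *: cos (2 * pi * (a + k%:~R * x))).
    by rewrite scalerA mulVf// scale1r.
  apply: is_deriveZ.
  have h : is_derive x 1 (fun x : R => 2 * pi * (a + k%:~R * x)) (2 * pi * k%:~R).
    have -> : (fun x : R => 2 * pi * (a + k%:~R * x)) =
      cst (2 * pi * a) + (2 * pi * k%:~R) *: (@id R).
      by apply/funext => y /=; rewrite mulrDr mulrA.
    rewrite -[X in is_derive _ _ _ X]add0r -[X in is_derive _ _ _ (_ + X)]scaler1.
    by apply: is_deriveD; apply: is_deriveZ.
  rewrite [X in is_derive _ _ _ X]mulrC.
  exact: (@is_derive1_comp _ (@sin R) (fun x : R => 2 * pi * (a + k%:~R * x)) x _ _ (is_derive_sin _) h).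
rewrite (@continuous_FTC2 _ _ F)//.
- rewrite /F mulr1 mulr0 addr0 sin2Dint -EFinB subrr//.
- apply: continuous_subspaceT => x; apply: continuous_comp; last exact: continuous_cos2.
  by apply: continuousD; [exact: cvg_cst|apply: continuousM; [exact: cvg_cst|exact: cvg_id]].
- have cF x : {for x, continuous F}.
    by apply: differentiable_continuous; apply/derivable1_diffP; exact: ex_derive.
  split; first by move=> x _; exact: ex_derive.
  + exact: cvg_at_right_filter (cF 0).
  + exact: cvg_at_left_filter (cF 1).
- by move=> x _; rewrite derive1E derive_val.
Qed.

(** The frequency is a function rather than a row vector: dropping the first
    coordinate is then a mere composition, as needed for inductions on [d]. *)
Definition phase (d : nat) (k : 'I_d -> int) (t : d.-tuple RR) : R :=
  \sum_(i < d) (k i)%:~R * (tnth t i : R).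

Lemma measurable_phase d (k : 'I_d -> int) : measurable_fun setT (phase k : d.-tuple RR -> RR).
Proof.
apply: measurable_sum => i; apply: measurable_funM => //.
exact: measurable_tnth.
Qed.

(** Keeping the shift [a] arbitrary makes the induction on [d] work, since Fubini
    hands the first coordinate over to the shift; it also covers the sine, which
    is a shifted cosine. *)
Lemma integral_cos2_phase (d : nat) (a : R) (k : 'I_d -> int) :
  (\int[torus_measure R d]_t (cos2 (a + phase k t))%:E =
   (if [forall i, k i == 0] then cos2 a else 0)%:E)%E.
Proof.
elim: d a k => [|d IH] a k.
  have -> : [forall i, k i == 0] = true by apply/forallP => -[].
  rewrite /= integral_dirac//; last first.
    apply/measurable_EFinP; apply: (measurableT_comp measurable_cos2).
    apply: measurable_funD => //; exact: measurable_phase.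
  by rewrite diracT mul1e /phase big_ord0 addr0.
have mk : measurable_fun setT (fun t => a + phase k t).
  by apply: measurable_funD => //; exact: measurable_phase.
have mkc : measurable_fun setT (fun t => (cos2 (a + phase k t))%:E).
  by apply/measurable_EFinP; exact: (measurableT_comp measurable_cos2 mk).
rewrite /= integral_distribution//; last first.
  apply: (@integrable_cos2 _ _ _ (fun p => a + phase k (tcons p))).
  exact: measurableT_comp mk (@measurable_tcons R d).
rewrite -integral12_prod_meas1; last first.
  apply: (@integrable_cos2 _ _ _ (fun p => a + phase k (tcons p))).
  exact: measurableT_comp mk (@measurable_tcons R d).
rewrite /fubini_F.
under eq_integral => x _.
  under eq_integral => y _.
    rewrite /= /phase big_ord_recl addrA tnth0.
    under eq_bigr do rewrite tnthS.
    over.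
  rewrite (IH (a + (k ord0)%:~R * x) (fun i => k (lift ord0 i))).
  over.
rewrite /=.
have -> : [forall i, k i == 0] = (k ord0 == 0) && [forall i, k (lift ord0 i) == 0].
  apply/forallP/andP => [h|[h0 /forallP h] i]; first by split => //; apply/forallP => i.
  by case: (unliftP ord0 i) => [j ->|->].
case: [forall i, k (lift ord0 i) == 0]; last by rewrite andbF integral0.
by rewrite andbT integral_cos2_1d.
Qed.

Lemma torus_box (d : nat) (A : 'I_d -> set RR) : (forall i, measurable (A i)) ->
  torus_measure R d [set t | forall i, A i (tnth t i)] =
  (\prod_(i < d) leb01 (A i))%E.
Proof.
elim: d A => [|d IH] A mA.
  rewrite big_ord0 /= (_ : [set t | _] = setT) ?diracT//.
  by apply/seteqP; split => // t _ [].
rewrite big_ord_recl -(IH (fun i => A (lift ord0 i)))//=.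
rewrite /distribution /pushforward -product_measure1E//; last first.
  rewrite (_ : [set t | _] = \bigcap_(i in setT) ((fun t => tnth t i) @^-1` (A (lift ord0 i)))).
    apply: fin_bigcap_measurable => // i _.
    by rewrite -[X in measurable X]setTI; apply: measurable_tnth.
  by apply/seteqP; split => [t h i _|t h i]; [exact: h|exact: (h i I)].
congr (_ _); apply/seteqP; split => [[x t] h|[x t] [/= h0 h] i] /=.
  by split => [|i]; [have := h ord0|have := h (lift ord0 i)]; rewrite /= ?tnth0 ?tnthS.
by case: (unliftP ord0 i) => [j ->|->]; rewrite /= ?tnth0 ?tnthS.
Qed.

Lemma leb01_itv (a b : R) : 0 <= a -> b <= 1 -> a < b ->
  @leb01 R `]a, b[%classic = (b - a)%:E.
Proof.
move=> a0 b1 ab; rewrite /leb01 /mrestr setIidl.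
  by rewrite lebesgue_measure_itv/= lte_fin ab EFinB.
by move=> x /=; rewrite !in_itv/= => /andP[ax xb]; apply/andP; split; lra.
Qed.

Lemma torus_cube_ae (d : nat) :
  {ae torus_measure R d, forall t, forall i, 0 <= tnth t i < 1}.
Proof.
pose C := [set t : d.-tuple RR | forall i, `[0%R, 1%R[%classic (tnth t i)].
have C1 : torus_measure R d C = 1%E.
  rewrite (@torus_box d (fun=> `[0%R, 1%R[%classic)); last by move=> i; exact: measurable_itv.
  rewrite big1// => i _.
  by rewrite /leb01 /mrestr setIid lebesgue_measure_itv/= lte_fin ltr01 oppr0 adde0.
have mC : measurable C.
  rewrite (_ : C = \bigcap_(i in setT) ((fun t => tnth t i) @^-1` `[0%R, 1%R[%classic)).
    apply: fin_bigcap_measurable => // i _.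
    by rewrite -[X in measurable X]setTI; apply: measurable_tnth => //; exact: measurable_itv.
  by apply/seteqP; split => [t h i _|t h i]; [exact: h|exact: (h i I)].
exists (~` C); split; first exact: measurableC.
  have := probability_setC (torus_measure R d) mC.
  by rewrite C1 subee.
move=> t /= nt Ct; apply: nt => i; have := Ct i.
by rewrite /= in_itv.
Qed.

End Trig.

(** * Uniqueness of the Fourier coefficients of an integrable function *)

Section Indicator.
Context {R : realType}.

Lemma bernoulli (x : R) (n : nat) : -1 <= x -> 1 + n%:R * x <= (1 + x) ^+ n.
Proof.
move=> x1; elim: n => [|n IH]; first by rewrite mul0r addr0 expr0.
have x0 : 0 <= 1 + x by lra.
rewrite exprS; apply: le_trans (ler_wpM2l x0 IH).
rewrite -natr1; have := ler0n R n; nra.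
Qed.

(** By Bernoulli's inequality the product is at most [(1 - q ^ (2 m)) ^ K]. *)
Lemma pow_step_le (q : R) (m K : nat) : 0 <= q <= 1 ->
  (1 - q ^+ m) ^+ K * (1 + K%:R * q ^+ m) <= 1.
Proof.
move=> /andP[q0 q1].
have y0 : 0 <= q ^+ m by rewrite exprn_ge0.
have y1 : q ^+ m <= 1 by rewrite exprn_ile1.
set y := q ^+ m in y0 y1 *.
have h : 1 + K%:R * y <= (1 + y) ^+ K by apply: bernoulli; lra.
apply: (@le_trans _ _ ((1 - y) ^+ K * (1 + y) ^+ K)).
  by rewrite ler_wpM2l// exprn_ge0//; lra.
by rewrite -exprMn exprn_ile1//; nra.
Qed.

(** Polynomials in [v] that converge to the indicator function of [0 < v] at every
    point of [[-1, 1]], boundedly. With [q] the base of the inner power, the value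
    is [(1 - q ^ m) ^ (2 ^ m)], which is close to [1] when [2 q < 1] and close to
    [0] when [2 q > 1]. The threshold is put at [v = 1 / (n + 1)], so that the
    limit at [v = 0] is [0]; the exponent [m = (n + 1) ^ 2] makes a distance of
    order [1 / n] from the threshold sufficient. *)
Definition sharp_step (n : nat) (v : R) : R :=
  (1 - (1 / 2 - (v - n.+1%:R^-1) / 4) ^+ (n.+1 ^ 2)) ^+ (2 ^ (n.+1 ^ 2)).

Lemma sharp_step_bound (n : nat) (v : R) : -1 <= v <= 1 ->
  0 <= sharp_step n v <= 1 /\
  ((v <= 0 -> sharp_step n v <= 2 / n.+1%:R) /\
   (2 / n.+1%:R <= v -> 1 - 2 / n.+1%:R <= sharp_step n v)).
Proof.
move=> /andP[v0 v1]; rewrite /sharp_step.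
set e := n.+1%:R^-1; set q := _ - _ / 4; set m := (n.+1 ^ 2)%N; set K := (2 ^ m)%N.
have N0 : 0 < n.+1%:R :> R by rewrite ltr0n.
have e0 : 0 < e by rewrite invr_gt0.
have e1 : e <= 1 by rewrite invf_le1// ler1n.
have q01 : 0 <= q <= 1 by apply/andP; rewrite /q; split; lra.
have [q0 q1] := andP q01.
have y01 : 0 <= 1 - q ^+ m <= 1.
  by rewrite subr_ge0 exprn_ile1//= gerBl exprn_ge0.
have [y0 y1] := andP y01.
have mE : m%:R * e = n.+1%:R.
  by rewrite /m natrX expr2 mulfK// gt_eqF.
have KE : K%:R * q ^+ m = (2 * q) ^+ m by rewrite /K natrX exprMn.
split; first by rewrite exprn_ge0//= exprn_ile1.
have e2 : 2 / n.+1%:R = 2 * e by [].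
split=> hv.
  have h := @pow_step_le q m K q01; rewrite KE in h.
  have h2 : 1 + m%:R * (e / 2) <= (2 * q) ^+ m.
    apply: le_trans (bernoulli _ _) _; first by lra.
    by rewrite lerXn2r ?nnegrE// /q; lra.
  rewrite mulrA mE in h2.
  set P := (1 - q ^+ m) ^+ K in h *.
  have P0 : 0 <= P by rewrite exprn_ge0.
  rewrite ler_pdivlMr//; nra.
have hy : 1 - (2 * q) ^+ m <= (1 - q ^+ m) ^+ K.
  by rewrite -KE -mulrN; apply: bernoulli; lra.
apply: le_trans hy; rewrite lerB//.
have x1 : 2 * q <= 1 - e / 2 by rewrite /q; lra.
apply: (@le_trans _ _ ((1 - e / 2) ^+ m)).
  by rewrite lerXn2r ?nnegrE//; lra.
have q2 : 0 <= 1 - e / 2 <= 1 by apply/andP; split; lra.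
have h3 : (1 - e / 2) ^+ m * (1 + m%:R * (e / 2)) <= 1.
  apply: (@le_trans _ _ ((1 - e / 2) ^+ m * (1 + e / 2) ^+ m)).
    rewrite ler_wpM2l ?exprn_ge0//; first by lra.
    by apply: bernoulli; lra.
  by rewrite -exprMn exprn_ile1//; nra.
rewrite mulrA mE in h3.
set P := (1 - e / 2) ^+ m in h3 *.
have P0 : 0 <= P by rewrite exprn_ge0//; lra.
rewrite ler_pdivlMr//; nra.
Qed.

Lemma sharp_step01 n (v : R) : -1 <= v <= 1 -> 0 <= sharp_step n v <= 1.
Proof. by move=> /(sharp_step_bound n)[]. Qed.

Lemma sharp_step_cvg (v : R) : -1 <= v <= 1 ->
  sharp_step n v @[n --> \oo] --> ((0 < v)%R%:R : R).
Proof.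
move=> v01.
have c0 : (2 / n.+1%:R : R) @[n --> \oo] --> (0 : R).
  rewrite -(mulr0 (2 : R)); apply: cvgM; [exact: cvg_cst|exact: cvg_harmonic].
have c1 : (1 - 2 / n.+1%:R : R) @[n --> \oo] --> (1 : R).
  rewrite -[X in _ --> X]subr0; apply: cvgB => //; exact: cvg_cst.
have [v0|v0] := ltP 0 v; last first.
  apply: (@squeeze_cvgr _ _ _ _ (cst 0) (fun n => 2 / n.+1%:R)) => //; last exact: cvg_cst.
  apply: nearW => n; have [/andP[s0 _] [h _]] := sharp_step_bound n v01.
  by rewrite s0/= h.
apply: (@squeeze_cvgr _ _ _ _ (fun n => 1 - 2 / n.+1%:R) (cst 1)) => //; last exact: cvg_cst.
have : \forall n \near \oo, 2 / n.+1%:R < v by apply: (cvgr_lt _ c0).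
apply: filterS => n hn; have [/andP[_ s1] [_ h]] := sharp_step_bound n v01.
by rewrite s1 andbT h// ltW.
Qed.

(** For [a] in the unit interval this is [sin (pi x) sin (pi (x - a))], a
    trigonometric polynomial of degree one that is positive exactly where
    [a < x], for [x] in the unit interval. *)
Definition ray_sign (a x : R) : R :=
  if a < 0 then 1 else if 1 <= a then -1 else
  2^-1 * (cos (pi * a) - cos2 (x - a / 2)).

Lemma ray_sign_bound a x : -1 <= ray_sign a x <= 1.
Proof.
rewrite /ray_sign; case: ifP => _; first by lra.
case: ifP => _; first by lra.
have := cos_geN1 (pi * a); have := cos_le1 (pi * a).
have := cos_geN1 (2 * pi * (x - a / 2)); have := cos_le1 (2 * pi * (x - a / 2)).
by rewrite /cos2; lra.
Qed.

Lemma ray_sign_gt0 a x : 0 <= x < 1 -> (0 < ray_sign a x) = (a < x).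
Proof.
move=> /andP[x0 x1]; rewrite /ray_sign; case: (ltP a 0) => [a0|a0].
  by rewrite ltr01 (lt_le_trans a0).
case: (leP 1 a) => [a1|a1].
  by rewrite oppr_gt0 ltr10 ltNge (ltW (lt_le_trans x1 a1)).
have -> : 2^-1 * (cos (pi * a) - cos2 (x - a / 2)) = sin (pi * x) * sin (pi * (x - a)).
  rewrite /cos2.
  have -> : pi * a = pi * x - pi * (x - a) by lra.
  have -> : 2 * pi * (x - a / 2) = pi * x + pi * (x - a) by lra.
  by rewrite cosB cosD; lra.
have p0 := @pi_gt0 R.
have [->|xn0] := eqVneq x 0; first by rewrite mulr0 sin0 mul0r ltxx ltNge a0.
have xp : 0 < x by rewrite lt_neqAle eq_sym xn0.
have sx : 0 < sin (pi * x).
  by apply: sin_gt0_pi; rewrite mulr_gt0//= gtr_pMr.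
rewrite pmulr_rgt0//; apply/idP/idP => [|ax].
  apply: contraTT; rewrite -!leNgt => xa.
  have -> : pi * (x - a) = - (pi * (a - x)) by lra.
  rewrite sinN oppr_le0; apply: sin_ge0_pi.
  by rewrite mulr_ge0 ?subr_ge0 ?(ltW p0)//= ger_pMr//; lra.
apply: sin_gt0_pi; rewrite mulr_gt0 ?subr_gt0//= gtr_pMr//; lra.
Qed.

End Indicator.

Section Uniqueness.
Context {R : realType} (d : nat).
Local Notation RR := (measurableTypeR R).
Local Notation T := (d.-tuple RR).
Local Notation mu := (torus_measure R d).

(** Product to sum, which makes trigonometric polynomials stable under products. *)
Lemma cos2_prod (x y : R) : 2^-1 * (cos2 (x + y) + cos2 (x - y)) = cos2 x * cos2 y.
Proof. by rewrite !cos2D cos2N sin2N; field. Qed.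

(** Shifts [a] are arbitrary so that sines are included. The inductive form lets
    measurability, boundedness and vanishing integrals be checked on generators. *)
Inductive trig_poly : (T -> R) -> Prop :=
| trig_cos a k : trig_poly (fun t => cos2 (a + phase k t))
| trig_add f g : trig_poly f -> trig_poly g -> trig_poly (fun t => f t + g t)
| trig_scale c f : trig_poly f -> trig_poly (fun t => c * f t).

Lemma trig_cst c : trig_poly (fun=> c).
Proof.
have := trig_scale c (trig_cos 0 (fun=> 0)).
congr trig_poly; apply/funext => t.
by rewrite /phase big1 ?addr0 /cos2 ?mulr0 ?cos0 ?mulr1// => i _; rewrite mul0r.
Qed.

Lemma trig_sub f g : trig_poly f -> trig_poly g -> trig_poly (fun t => f t - g t).
Proof.
move=> hf hg; have := trig_add hf (trig_scale (-1) hg).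
by congr trig_poly; apply/funext => t; rewrite mulN1r.
Qed.

Lemma trig_mul f g : trig_poly f -> trig_poly g -> trig_poly (fun t => f t * g t).
Proof.
move=> hf hg; elim: hf => [a k|f1 f2 _ h1 _ h2|c f1 _ h1].
- elim: hg => [b l|g1 g2 _ h1 _ h2|c g1 _ h1].
  + have := trig_scale 2^-1 (trig_add (trig_cos (a + b) (fun i => k i + l i))
       (trig_cos (a - b) (fun i => k i - l i))).
    congr trig_poly; apply/funext => t.
    have -> : phase (fun i => k i + l i) t = phase k t + phase l t.
      by rewrite /phase -big_split; apply: eq_bigr => i _; rewrite intrD mulrDl.
    have -> : phase (fun i => k i - l i) t = phase k t - phase l t.
      by rewrite /phase -sumrB; apply: eq_bigr => i _; rewrite intrB mulrBl.
    have -> : a + b + (phase k t + phase l t) = (a + phase k t) + (b + phase l t) by ring.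
    have -> : a - b + (phase k t - phase l t) = (a + phase k t) - (b + phase l t) by ring.
    exact: cos2_prod.
  + have := trig_add h1 h2; congr trig_poly; apply/funext => t; by rewrite mulrDr.
  + have := trig_scale c h1; congr trig_poly; apply/funext => t; by rewrite mulrCA.
- have := trig_add h1 h2; congr trig_poly; apply/funext => t; by rewrite mulrDl.
- have := trig_scale c h1; congr trig_poly; apply/funext => t; by rewrite mulrA.
Qed.

Lemma trig_exp f n : trig_poly f -> trig_poly (fun t => f t ^+ n).
Proof.
move=> hf; elim: n => [|n IH]; first exact: trig_cst.
by have := trig_mul hf IH; congr trig_poly; apply/funext => t; rewrite exprS.
Qed.

Lemma trig_sharp_step f n : trig_poly f -> trig_poly (fun t => sharp_step n (f t)).
Proof.
move=> hf; apply/trig_exp/trig_sub; first exact: trig_cst.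
apply/trig_exp/trig_sub; first exact: trig_cst.
have := trig_scale 4^-1 (trig_sub hf (trig_cst n.+1%:R^-1)).
by congr trig_poly; apply/funext => t; rewrite mulrC.
Qed.

Lemma trig_prod (I : Type) (s : seq I) (F : I -> T -> R) :
  (forall i, trig_poly (F i)) -> trig_poly (fun t => \prod_(i <- s) F i t).
Proof.
move=> hF; elim: s => [|i s IH].
  by have := trig_cst 1; congr trig_poly; apply/funext => t; rewrite big_nil.
by have := trig_mul (hF i) IH; congr trig_poly; apply/funext => t; rewrite big_cons.
Qed.

Lemma trig_ray_sign a (j : 'I_d) : trig_poly (fun t => ray_sign a (tnth t j)).
Proof.
rewrite /ray_sign; case: (a < 0); first exact: trig_cst.
case: (1 <= a); first exact: trig_cst.
have := trig_scale 2^-1 (trig_sub (trig_cst (cos (pi * a)))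
   (trig_cos (- (a / 2)) (fun i => (i == j)%:R))).
congr trig_poly; apply/funext => t.
congr (_ * (_ - cos2 _)); rewrite addrC; congr (_ - _).
rewrite /phase (bigD1 j)//= eqxx mul1r big1 ?addr0// => i /negbTE ->.
by rewrite mul0r.
Qed.

Lemma trig_measurable f : trig_poly f -> measurable_fun setT (f : T -> RR).
Proof.
elim=> [a k|f1 g1 _ h1 _ h2|c f1 _ h1].
- apply: (measurableT_comp measurable_cos2); apply: measurable_funD => //.
  exact: measurable_phase.
- exact: measurable_funD.
- exact: measurable_funM.
Qed.

Lemma trig_bounded f : trig_poly f -> exists2 M, 0 <= M & forall t, `|f t| <= M.
Proof.
elim=> [a k|f1 g1 _ [M M0 h1] _ [N N0 h2]|c f1 _ [M M0 h1]].
- by exists 1 => // t; exact: cos_max.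
- exists (M + N); first exact: addr_ge0.
  by move=> t; rewrite (le_trans (ler_normD _ _))// lerD.
- exists (`|c| * M); first exact: mulr_ge0.
  by move=> t; rewrite normrM ler_wpM2l.
Qed.

Variable u : T -> R.
Hypothesis ui : mu.-integrable setT (EFin \o u).
Hypothesis u0 : forall a k, (\int[mu]_t (u t * cos2 (a + phase k t))%:E = 0)%E.

Let mu_ : measurable_fun setT (u : T -> RR).
Proof. by apply/measurable_EFinP; exact: measurable_int ui. Qed.

Lemma integrable_trig f : trig_poly f -> mu.-integrable setT (fun t => (u t * f t)%:E).
Proof.
move=> hf; have [M M0 fM] := trig_bounded hf.
apply: (@le_integrable _ _ _ mu _ measurableT _ (fun t => M%:E * (u t)%:E)%E).
- by apply/measurable_EFinP; apply: measurable_funM => //; exact: trig_measurable.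
- move=> t _; rewrite -EFinM !abse_EFin lee_fin !normrM (ger0_norm M0) mulrC.
  by rewrite ler_wpM2r.
- exact: integrableZl.
Qed.

Lemma integral_trig f : trig_poly f -> (\int[mu]_t (u t * f t)%:E = 0)%E.
Proof.
elim=> [a k|f1 g1 h1 i1 h2 i2|c f1 h1 i1]; first exact: u0.
- under eq_integral do rewrite mulrDr EFinD.
  rewrite integralD//; last 2 first; [exact: integrable_trig|exact: integrable_trig|].
  by rewrite i1 i2 adde0.
- under eq_integral do rewrite mulrCA EFinM.
  by rewrite integralZl//; [rewrite i1 mule0|exact: integrable_trig].
Qed.

(** Boxes given by a list of lower bounds on coordinates: concatenating lists
    intersects the boxes, so that they form a pi-system. *)
Definition ray_box (s : seq ('I_d * R)) : set T :=
  [set t | all (fun p => p.2 < tnth t p.1) s].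

Lemma mem_ray_box s t : (t \in ray_box s) = all (fun p => p.2 < tnth t p.1) s.
Proof. by apply/idP/idP; rewrite in_setE. Qed.

Lemma measurable_ray_box s : measurable (ray_box s).
Proof.
elim: s => [|[j a] s IH].
  by rewrite (_ : ray_box _ = setT)//; apply/seteqP; split.
rewrite (_ : ray_box _ = ((fun t => tnth t j) @^-1` `]a, +oo[%classic) `&` ray_box s).
  apply: measurableI => //; rewrite -[X in measurable X]setTI.
  by apply: measurable_tnth => //; exact: measurable_itv.
by apply/seteqP; split => t /=; rewrite /ray_box/= in_itv/= andbT => /andP.
Qed.

Definition ray_box_approx (s : seq ('I_d * R)) (n : nat) (t : T) : R :=
  \prod_(p <- s) sharp_step n (ray_sign p.2 (tnth t p.1)).

Lemma trig_ray_box_approx s n : trig_poly (ray_box_approx s n).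
Proof. by apply: trig_prod => p; apply: trig_sharp_step; exact: trig_ray_sign. Qed.

Lemma ray_box_approx_le1 s n t : `|ray_box_approx s n t| <= 1.
Proof.
rewrite /ray_box_approx; elim: s => [|p s IH]; first by rewrite big_nil normr1.
rewrite big_cons normrM mulr_ile1//.
by have /andP[s0 s1] := sharp_step01 n (ray_sign_bound p.2 (tnth t p.1)); rewrite ger0_norm.
Qed.

Lemma cvg_ray_box_approx s t : (forall i, 0 <= tnth t i < 1) ->
  ray_box_approx s n t @[n --> \oo] --> (\1_(ray_box s) t : R).
Proof.
move=> t01; rewrite indicE /ray_box_approx; elim: s => [|p s IH].
  under eq_fun do rewrite big_nil.
  rewrite mem_set//; exact: cvg_cst.
have -> : (t \in ray_box (p :: s))%:R = (p.2 < tnth t p.1)%R%:R * (t \in ray_box s)%:R :> R.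
  by rewrite !mem_ray_box/= -natrM mulnb.
under eq_fun do rewrite big_cons.
apply: cvgM => //.
by rewrite -(ray_sign_gt0 _ (t01 p.1)); apply: sharp_step_cvg; exact: ray_sign_bound.
Qed.

(** The indicator function of a box is a bounded pointwise limit, on the unit
    cube, of trigonometric polynomials; their integrals against [u] vanish. *)
Lemma integral_ray_box s : (\int[mu]_(t in ray_box s) (u t)%:E = 0)%E.
Proof.
have mB := measurable_ray_box s.
have -> : (\int[mu]_(t in ray_box s) (u t)%:E = \int[mu]_t (u t * \1_(ray_box s) t)%:E)%E.
  rewrite integral_mkcond; apply: eq_integral => t _.
  by rewrite patchE indicE; case: ifP => _; rewrite ?mulr1 ?mulr0.
have mu1 : mu.-integrable setT (fun t => (u t * \1_(ray_box s) t)%:E).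
  apply: (@le_integrable _ _ _ mu _ measurableT _ (EFin \o u)) => //.
    apply/measurable_EFinP; apply: measurable_funM => //.
  move=> t _; rewrite !abse_EFin lee_fin normrM ler_piMr// indicE.
  by case: (_ \in _); rewrite ?normr1 ?normr0.
have cvg_f : {ae mu, forall t, [set: T] t ->
    (u t * ray_box_approx s n t)%:E @[n --> \oo] --> (u t * \1_(ray_box s) t)%:E}.
  apply: (@filterS _ _ (ae_filter_ringOfSetsType mu) _ _ _ (@torus_cube_ae R d)) => t t01 _.
  apply: cvg_EFin; first by apply: nearW.
  by apply: cvgM; [exact: cvg_cst|exact: cvg_ray_box_approx].
have dom : {ae mu, forall t n, [set: T] t ->
    (`|(u t * ray_box_approx s n t)%:E| <= `|(u t)%:E|)%E}.
  apply: aeW => t n _; rewrite !abse_EFin lee_fin normrM ler_piMr//.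
  exact: ray_box_approx_le1.
have [_ _ cv] := @dominated_convergence _ _ _ mu setT measurableT
  (fun n t => (u t * ray_box_approx s n t)%:E)
  (fun t => (u t * \1_(ray_box s) t)%:E) (fun t => `|(u t)%:E|)%E
  (fun n => measurable_int _ (integrable_trig (trig_ray_box_approx s n)))
  (measurable_int _ mu1) cvg_f (integrable_abse ui) dom.
have cv0 : (fun n => \int[mu]_t (u t * ray_box_approx s n t)%:E)%E = cst 0%E.
  by apply/funext => n; apply: integral_trig; exact: trig_ray_box_approx.
by move: cv; rewrite cv0 => /cvg_lim <-//; rewrite lim_cst.
Qed.

(** Half-lines generate the Borel sets of the line, and the coordinates generate
    the measurable sets of tuples. *)
Lemma ray_box_generate :
  @measurable _ (d.-tuple RR) = <<s range ray_box >>.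
Proof.
apply/seteqP; split; last first.
  apply: smallest_sub; first exact: sigma_algebra_measurable.
  by move=> _ [s _ <-]; exact: measurable_ray_box.
apply: smallest_sub; first exact: smallest_sigma_algebra.
rewrite -bigcup_seq; apply: bigcup_sub => i _.
have H : sigma_algebra [set: RR] [set B : set RR |
    <<s range ray_box >> ((fun t : T => tnth t i) @^-1` B)].
  have [s0 sC sU] := smallest_sigma_algebra [set: T] (range ray_box).
  split=> [|B /= /sC|F hF].
  - by rewrite /= preimage_set0.
  - by rewrite !setTD.
  - by rewrite /= preimage_bigcup; exact: sU.
move=> _ [B mB <-]; rewrite setTI.
have mB' : (RGenOInfty.G (R:=R)).-sigma.-measurable B.
  by rewrite -RGenOInfty.measurableE.
move: B {mB} mB'; apply: smallest_sub; first exact: H.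
move=> _ [x ->] /=; apply: sub_sigma_algebra; exists [:: (i, x)] => //.
Qed.

(** The sets on which [u] integrates to zero are stable under complements and
    countable disjoint unions and contain the boxes, which are stable under
    intersections and generate; hence all measurable sets are among them. *)
Theorem fourier_unique : {ae mu, forall t, u t = 0}.
Proof.
have uA A : measurable A -> (\int[mu]_(t in A) (u t)%:E = 0)%E.
  rewrite ray_box_generate; apply: (@dynkin_induction _ T (range ray_box)
    (fun A => (\int[mu]_(t in A) (u t)%:E = 0)%E)); first exact: ray_box_generate.
  - move=> _ _ [s _ <-] [r _ <-]; exists (s ++ r) => //.
    by apply/seteqP; split => t; rewrite /ray_box /= all_cat => /andP.
  - rewrite (_ : setT = ray_box [::]); first exact: integral_ray_box.
    by apply/seteqP; split.
  - by move=> _ [s _ <-]; exact: integral_ray_box.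
  - move=> S mS S0; have := integral_ray_box [::].
    rewrite (_ : ray_box [::] = S `|` ~` S); last by rewrite setUv; apply/seteqP; split.
    rewrite integral_setU//.
    + by rewrite S0 add0e.
    + exact: measurableC.
    + by apply/measurable_EFinP; exact: measurable_funTS.
    + exact/disj_setPCl.
  - move=> F mF tF F0; rewrite integral_bigcup//; first by rewrite eseries0.
    by apply: integrableS ui => //; exact: bigcup_measurable.
have := @integral_ae_eq _ _ _ mu setT measurableT (cst 0%E) (EFin \o u) ui.
case=> //.
  by move=> E _ mE; rewrite integral0 uA.
move=> A [mA A0 hA]; exists A; split => // t /= ut; apply: hA => /=.
by move=> h; apply: ut; have [] := h I.
Qed.

End Uniqueness.

(** * Sampling of exponentials on a multiple lattice *)

Section Exponentials.
Context {R : realType}.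
Local Notation C := (R[i]).

Lemma cmod_ge0 (w : C) : 0 <= cmod w.
Proof. by case: w => a b; exact: sqrtr_ge0. Qed.

Lemma cmodM (w v : C) : cmod (w * v) = cmod w * cmod v.
Proof. exact: Normc.normcM. Qed.

Lemma cmodD (w v : C) : cmod (w + v) <= cmod w + cmod v.
Proof. exact: le_normcD. Qed.

Lemma cmodN (w : C) : cmod (- w) = cmod w.
Proof. exact: normcN. Qed.

Lemma cmodB (w v : C) : cmod (w - v) = cmod (v - w).
Proof. by rewrite -cmodN opprB. Qed.

Lemma cmod0 : cmod (0 : C) = 0.
Proof. exact: Normc.normc0. Qed.

Lemma cmod_eq0 (w : C) : cmod w = 0 -> w = 0.
Proof. exact: Normc.eq0_normc. Qed.

Lemma cmod_bool (b : bool) : cmod (b%:R : C) = b%:R.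
Proof. by case: b; [exact: Normc.normc1|exact: Normc.normc0]. Qed.

Lemma cmod_sum (I : Type) (s : seq I) (P : pred I) (F : I -> C) :
  cmod (\sum_(i <- s | P i) F i) <= \sum_(i <- s | P i) cmod (F i).
Proof.
elim/big_ind2: _ => [|x1 x2 y1 y2 h1 h2|//]; first by rewrite cmod0.
by rewrite (le_trans (cmodD _ _))// lerD.
Qed.

Lemma Re_le_cmod (w : C) : `|complex.Re w| <= cmod w.
Proof.
case: w => a b /=; rewrite -sqrtr_sqr ler_sqrt; last by rewrite addr_ge0// sqr_ge0.
by rewrite lerDl sqr_ge0.
Qed.

Lemma Im_le_cmod (w : C) : `|complex.Im w| <= cmod w.
Proof.
case: w => a b /=; rewrite -sqrtr_sqr ler_sqrt; last by rewrite addr_ge0// sqr_ge0.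
by rewrite lerDr sqr_ge0.
Qed.

Lemma cmod_le (w : C) : cmod w <= `|complex.Re w| + `|complex.Im w|.
Proof.
case: w => a b /=; rewrite -[leRHS]ger0_norm ?addr_ge0// -sqrtr_sqr ler_sqrt ?sqr_ge0//.
rewrite -(real_normK (num_real a)) -(real_normK (num_real b)).
have := normr_ge0 a; have := normr_ge0 b; nra.
Qed.

Lemma expi2D (a b : R) : expi2 (a + b) = expi2 a * expi2 b.
Proof.
rewrite /expi2 -!/(cos2 _) -!/(sin2 _) cos2D sin2D; simpc.
by congr (_ +i* _)%C; rewrite addrC.
Qed.

Lemma expi2_int (k : int) : expi2 (k%:~R : R) = 1.
Proof. by rewrite /expi2 -/(cos2 _) -/(sin2 _); have [-> ->] := @cos2_int R k. Qed.

Lemma expi20 : expi2 (0 : R) = 1.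
Proof. exact: (expi2_int 0). Qed.

Lemma cmod_expi2 (a : R) : cmod (expi2 a) = 1.
Proof. by rewrite /cmod /expi2 /= cos2Dsin2 sqrtr1. Qed.

Lemma expi2Mn (a : R) (j : nat) : expi2 (j%:R * a) = expi2 a ^+ j.
Proof.
elim: j => [|j IH]; first by rewrite mul0r expi20.
by rewrite -natr1 mulrDl mul1r expi2D IH exprSr.
Qed.

Lemma expi2_neq1 (a : R) : 0 < a < 1 -> expi2 a != 1.
Proof.
move=> /andP[a0 a1]; apply/eqP => -[+ _].
have -> : 2 * pi * a = (pi * a) *+ 2 :> R by lra.
rewrite cos_mulr2n cos2sin2.
have : 0 < sin (pi * a).
  by apply: sin_gt0_pi; rewrite mulr_gt0 ?pi_gt0//= gtr_pMr ?pi_gt0.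
by set s := sin _; nra.
Qed.

(** A geometric sum over the powers of an [M]-th root of unity. *)
Lemma expi2_mean (M : nat) (m : int) : (0 < M)%N ->
  M%:R^-1 * \sum_(j < M) expi2 (j%:R * (m%:~R / M%:R)) = ((M%:Z %| m)%Z)%:R :> C.
Proof.
move=> M0; have MR : M%:R != 0 :> R by rewrite pnatr_eq0 -lt0n.
have MC : M%:R != 0 :> C by rewrite pnatr_eq0 -lt0n.
have Mz : M%:Z != 0 by rewrite eqz_nat -lt0n.
have mE := divz_eq m M%:Z.
set q := (m %/ M)%Z in mE; set r := (m %% M)%Z in mE.
have aE : m%:~R / M%:R = q%:~R + r%:~R / M%:R :> R.
  by rewrite {1}mE intrD intrM mulrDl mulfK.
have [dvd|ndvd] := boolP (M%:Z %| m)%Z.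
  have r0 : r = 0 by exact/dvdz_mod0P.
  rewrite (eq_bigr (fun=> 1)) => [|j _].
    by rewrite sumr_const card_ord -[1 *+ M]/(M%:R) mulVf.
  rewrite aE r0 mul0r addr0 expi2Mn expi2_int expr1n//.
have r0 : 0 < r < M%:Z.
  by rewrite ltz_mod// andbT lt_neqAle modz_ge0// andbT eq_sym; apply: contra ndvd => /eqP r0; exact/dvdz_mod0P.
set w := expi2 (m%:~R / M%:R : R).
have w1 : w != 1.
  rewrite /w aE expi2D expi2_int mul1r; apply: expi2_neq1.
  case/andP: r0 => r0 rM; rewrite divr_gt0 ?ltr0z ?ltr0n//=.
  by rewrite ltr_pdivrMr ?ltr0n// mul1r -[M%:R]/(M%:Z%:~R) ltr_int.
rewrite (eq_bigr (fun j : 'I_M => w ^+ j)); last by move=> j _; rewrite expi2Mn.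
have : (w - 1) * \sum_(j < M) w ^+ j = 0.
  by rewrite -subrX1 /w -expi2Mn mulrC divfK// expi2_int subrr.
by move/eqP; rewrite mulf_eq0 subr_eq0 (negbTE w1)/= => /eqP ->; rewrite mulr0.
Qed.

End Exponentials.

Section Aliasing.
Context {R : realType} (d : nat).
Local Notation C := (R[i]).
Implicit Types (h k z : 'rV[int]_d) (I : {fset 'rV[int]_d}).

Definition trig_sum (F : seq 'rV[int]_d) (c : 'rV[int]_d -> C) (x : 'rV[R]_d) : C :=
  \sum_(k <- F) c k * expi2 (dotp k x).

Lemma dotp_lattice_point k z (M j : nat) : exists q : int,
  dotp k (lattice_point R z M j) = j%:R * ((zdotp k z)%:~R / M%:R) + q%:~R.
Proof.
exists (- \sum_(i < d) k ord0 i * Num.floor (j%:R / M%:R * (z ord0 i)%:~R : R)).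
rewrite /dotp /zdotp rmorphN !rmorph_sum/= -sumrN mulr_suml mulr_sumr -big_split/=.
apply: eq_bigr => i _; rewrite mxE /frac1 !intrM mulrBr; congr (_ - _).
by rewrite -!mulrA mulrCA; congr (_ * (_ * _)); exact: mulrC.
Qed.

(** On the lattice two exponentials agree or are orthogonal, according to whether
    their frequencies are congruent. *)
Lemma lattice_coef_expi2 k h z (M : nat) : (0 < M)%N ->
  lattice_coef (fun x : 'rV[R]_d => expi2 (dotp k x)) z M h =
  ((zdotp h z == zdotp k z %[mod M%:Z])%Z)%:R.
Proof.
move=> M0; rewrite eq_sym eqz_mod_dvd -expi2_mean// /lattice_coef; congr (_ * _).
apply: eq_bigr => j _.
have [q ->] := dotp_lattice_point k z M j.
rewrite !expi2D expi2_int mulr1 -expi2D; congr expi2.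
by rewrite intrB mulrBl mulrBr; congr (_ - _); rewrite mulrA.
Qed.

Lemma lattice_coef_sum (F : seq 'rV[int]_d) (c : 'rV[int]_d -> C) z M h :
  lattice_coef (trig_sum F c) z M h =
  \sum_(k <- F) c k * lattice_coef (fun x : 'rV[R]_d => expi2 (dotp k x)) z M h.
Proof.
rewrite /lattice_coef /trig_sum.
under eq_bigr do rewrite mulr_suml.
rewrite exchange_big/= mulr_sumr; apply: eq_bigr => k _.
rewrite mulrCA; congr (_ * _); rewrite mulr_sumr.
by apply: eq_bigr => j _; rewrite mulrA.
Qed.

Lemma sampling_op_sum (F : seq 'rV[int]_d) (c : 'rV[int]_d -> C) I L
    (z : nat -> 'rV[int]_d) M x :
  sampling_op I L z M (trig_sum F c) x =
  \sum_(k <- F) c k * sampling_op I L z M (fun x : 'rV[R]_d => expi2 (dotp k x)) x.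
Proof.
rewrite /sampling_op.
under eq_bigr do under eq_bigr do rewrite lattice_coef_sum mulr_suml.
under eq_bigr do rewrite exchange_big/=.
rewrite exchange_big/=; apply: eq_bigr => k _; rewrite mulr_sumr.
apply: eq_bigr => l _; rewrite mulr_sumr; apply: eq_bigr => h _.
by rewrite mulrA.
Qed.

Lemma mem_level I (z : nat -> 'rV[int]_d) M l h : h \in level I z M l ->
  [/\ h \in I, h \notin level_union I z M l &
    forall k, k \in I -> (zdotp h (z l) == zdotp k (z l) %[mod (M l)%:Z])%Z -> k = h].
Proof.
rewrite /level /unaliased !inE/= => /andP[/andP[h1 h2] /allP h3]; split => //.
move=> k kI hk; apply/eqP; apply: contraTT hk => kh.
by have := h3 _ kI; rewrite kh.
Qed.

Lemma level_unionP I (z : nat -> 'rV[int]_d) M l h :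
  reflect (exists2 i, (i < l)%N & h \in level I z M i) (h \in level_union I z M l).
Proof.
elim: l => [|l IH] /=; first by rewrite in_fset0; constructor => -[].
rewrite in_fsetU; apply: (iffP orP).
  case=> [/IH|hl]; last by exists l.
  by case=> i il hi; exists i => //; exact: ltnW.
case=> i.
rewrite ltnS leq_eqVlt => /orP[/eqP ->|il] hi; [by right|left].
by apply/IH; exists i.
Qed.

Lemma level_inj I (z : nat -> 'rV[int]_d) M i j h : h \in level I z M i -> h \in level I z M j -> i = j.
Proof.
move=> hi hj; have [ij|ij|//] := ltngtP i j.
- by have [_ /negP[]] := mem_level hj; apply/level_unionP; exists i.
- by have [_ /negP[]] := mem_level hi; apply/level_unionP; exists j.
Qed.

Variables (I : {fset 'rV[int]_d}) (L : nat) (z : nat -> 'rV[int]_d) (M : nat -> nat).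
Hypothesis M_gt0 : forall l, (l < L)%N -> (0 < M l)%N.
Hypothesis I_levels : I = (\bigcup_(l <- iota 0 L) level I z M l)%fset.

(** The sampling operator reproduces every exponential with frequency in [I]:
    on each level the only frequency that [k] could be mistaken for is itself. *)
Lemma sampling_op_exact k x : k \in I ->
  sampling_op I L z M (fun x : 'rV[R]_d => expi2 (dotp k x)) x = expi2 (dotp k x).
Proof.
move=> kI; rewrite /sampling_op.
have [l0 l0L kl0] : exists2 l, (l < L)%N & k \in level I z M l.
  have : k \in (\bigcup_(l <- iota 0 L) level I z M l)%fset by rewrite -I_levels.
  by move=> /bigfcupP [l]; rewrite mem_iota andbT add0n => lL kl; exists l.
rewrite (bigD1 (Ordinal l0L))//= [X in _ + X]big1 => [|l ll0].
  rewrite addr0 (big_fsetD1 k)//= lattice_coef_expi2 ?M_gt0// eqxx mul1r.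
  rewrite big_seq big1 ?addr0// => h; rewrite in_fsetD1 => /andP[hk /mem_level [_ _ h3]].
  rewrite lattice_coef_expi2 ?M_gt0//; case: eqP => [/eqP/(h3 _ kI) kh|]; last by rewrite mul0r.
  by rewrite kh eqxx in hk.
rewrite big_seq big1// => h hl; have [_ _ h3] := mem_level hl.
rewrite lattice_coef_expi2 ?M_gt0//; case: eqP => [/eqP/(h3 _ kI) kh|]; last by rewrite mul0r.
case/negP: ll0; apply/eqP/val_inj => /=; apply: (level_inj hl).
by rewrite -kh.
Qed.

(** Any other exponential is mistaken for at most one frequency per level. *)
Lemma sampling_op_bound k x :
  cmod (sampling_op I L z M (fun x : 'rV[R]_d => expi2 (dotp k x)) x) <= L%:R.
Proof.
rewrite /sampling_op (le_trans (cmod_sum _ _ _))//.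
rewrite -[X in _ <= X%:R]card_ord -sumr_const; apply: ler_sum => l _.
rewrite (le_trans (cmod_sum _ _ _))//.
under eq_bigr do rewrite cmodM cmod_expi2 mulr1 lattice_coef_expi2 ?M_gt0// cmod_bool.
have [[h hl hk]|no] := pselect (exists2 h, h \in level I z M l &
    (zdotp h (z l) == zdotp k (z l) %[mod (M l)%:Z])%Z).
  rewrite (big_fsetD1 h)//= hk big_seq big1 ?addr0// => h'; rewrite in_fsetD1 => /andP[h'h h'l].
  case: eqP => // /eqP h'k; have [h'I _ _] := mem_level h'l.
  have [_ _ h3] := mem_level hl.
  by case/eqP: h'h; apply: h3 => //; rewrite (eqP hk) eq_sym.
rewrite big_seq big1// => h hl; case: eqP => // /eqP hk.
by case: no; exists h.
Qed.

(** By linearity only the frequencies outside [I] contribute, each by its own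
    exponential and by its aliases. *)
Lemma sampling_error_bound (F : {fset 'rV[int]_d}) (c : 'rV[int]_d -> C) x :
  cmod (trig_sum F c x - sampling_op I L z M (trig_sum F c) x) <=
  (1 + L%:R) * \sum_(k <- (F `\` I)%fset) cmod (c k).
Proof.
rewrite sampling_op_sum /trig_sum -sumrB.
under eq_bigr do rewrite -mulrBr.
rewrite (big_fsetID _ (mem I))/= [X in cmod (X + _)]big1_fset => [|k].
  rewrite add0r (le_trans (cmod_sum _ _ _))// mulr_sumr.
  have -> : [fset x0 | x0 in F & x0 \notin I]%fset = (F `\` I)%fset.
    by apply/fsetP => k; rewrite !inE andbC.
  apply: ler_sum => k _; rewrite cmodM mulrC ler_wpM2r ?cmod_ge0//.
  rewrite (le_trans (cmodD _ _))// cmodN cmod_expi2 lerD2l.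
  exact: sampling_op_bound.
by rewrite !inE/= => /andP[_ kI] _; rewrite sampling_op_exact// subrr mulr0.
Qed.

End Aliasing.

(** * Linearity of the Fourier coefficients *)

Section FourierCoef.
Context {R : realType} (d : nat).
Local Notation RR := (measurableTypeR R).
Local Notation C := (R[i]).
Local Notation T := (d.-tuple RR).
Local Notation mu := (torus_measure R d).
Implicit Types (f g : 'rV[R]_d -> C) (h k : 'rV[int]_d).

Lemma dotp_tuple_row h (t : T) : dotp h (tuple_row t) = phase (fun i => h ord0 i) t.
Proof. by apply: eq_bigr => i _; rewrite mxE. Qed.

Lemma dotpD h k (x : 'rV[R]_d) : dotp (h + k) x = dotp h x + dotp k x.
Proof. by rewrite /dotp -big_split; apply: eq_bigr => i _; rewrite mxE intrD mulrDl. Qed.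

Lemma dotpN h (x : 'rV[R]_d) : dotp (- h) x = - dotp h x.
Proof. by rewrite /dotp -sumrN; apply: eq_bigr => i _; rewrite mxE intrN mulNr. Qed.

Lemma trig_cos_dotp a h : trig_poly (fun t : T => cos2 (a + dotp h (tuple_row t))).
Proof.
have := @trig_cos R d a (fun i => h ord0 i).
by congr trig_poly; apply/funext => t; rewrite dotp_tuple_row.
Qed.

Lemma trig_cos0 h : trig_poly (fun t : T => cos2 (dotp h (tuple_row t))).
Proof.
by have := trig_cos_dotp 0 h; congr trig_poly; apply/funext => t; rewrite add0r.
Qed.

Lemma trig_sin0 h : trig_poly (fun t : T => sin2 (dotp h (tuple_row t))).
Proof.
have := trig_cos_dotp (- 4^-1) h.
by congr trig_poly; apply/funext => t; rewrite sin2E addrC.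
Qed.

Lemma torus_L1D f g : torus_L1 f -> torus_L1 g -> torus_L1 (fun x => f x + g x).
Proof.
move=> [f1 f2] [g1 g2]; split.
- have := integrableD measurableT f1 g1; congr (mu.-integrable).
  by apply/funext => t /=; rewrite -EFinD; case: (f _) => a b; case: (g _).
- have := integrableD measurableT f2 g2; congr (mu.-integrable).
  by apply/funext => t /=; rewrite -EFinD; case: (f _) => a b; case: (g _).
Qed.

Lemma torus_intD f g : torus_L1 f -> torus_L1 g ->
  torus_int (fun x => f x + g x) = torus_int f + torus_int g.
Proof.
move=> [f1 f2] [g1 g2]; rewrite /torus_int; simpc; congr (_ +i* _)%C.
- rewrite -RintegralD//; apply: eq_Rintegral => t _.
  by case: (f _) => a b; case: (g _).
- rewrite -RintegralD//; apply: eq_Rintegral => t _.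
  by case: (f _) => a b; case: (g _).
Qed.

Lemma integrable_lin (a b : R) (u v : T -> R) :
  mu.-integrable setT (EFin \o u) -> mu.-integrable setT (EFin \o v) ->
  mu.-integrable setT (EFin \o (fun t => a * u t + b * v t)).
Proof.
move=> ui vi.
have := integrableD measurableT (integrableZl measurableT a ui) (integrableZl measurableT b vi).
by congr (mu.-integrable); apply/funext => t /=; rewrite EFinD !EFinM.
Qed.

Lemma Rintegral_lin (a b : R) (u v : T -> R) :
  mu.-integrable setT (EFin \o u) -> mu.-integrable setT (EFin \o v) ->
  Rintegral mu setT (fun t => a * u t + b * v t) =
  a * Rintegral mu setT u + b * Rintegral mu setT v.
Proof.
move=> ui vi; rewrite RintegralD//.
- by rewrite !RintegralZl.
- have := integrableZl measurableT a ui.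
  by congr (mu.-integrable); apply/funext => t /=; rewrite EFinM.
- have := integrableZl measurableT b vi.
  by congr (mu.-integrable); apply/funext => t /=; rewrite EFinM.
Qed.

Lemma ReM (a b c e : R) : complex.Re ((a +i* b)%C * (c +i* e)%C) = a * c + (- b) * e.
Proof. by simpc. Qed.

Lemma ImM (a b c e : R) : complex.Im ((a +i* b)%C * (c +i* e)%C) = b * c + a * e.
Proof. by rewrite [RHS]addrC. Qed.

Lemma torus_L1Z (c : C) f : torus_L1 f -> torus_L1 (fun x => c * f x).
Proof.
case: c => a b [f1 f2]; split.
- have := integrable_lin a (- b) f1 f2; congr (mu.-integrable).
  by apply/funext => t; rewrite /comp; case: (f _) => u v; rewrite ReM.
- have := integrable_lin b a f1 f2; congr (mu.-integrable).
  by apply/funext => t; rewrite /comp; case: (f _) => u v; rewrite ImM.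
Qed.

Lemma torus_intZ (c : C) f : torus_L1 f -> torus_int (fun x => c * f x) = c * torus_int f.
Proof.
case: c => a b [f1 f2]; rewrite /torus_int; apply/eqP; rewrite eq_complex ReM ImM.
rewrite -!Rintegral_lin//; apply/andP; split; apply/eqP; apply: eq_Rintegral => t _.
- by case: (f _) => u v; rewrite ReM.
- by case: (f _) => u v; rewrite ImM.
Qed.

Lemma torus_L1_expi2 f h : torus_L1 f -> torus_L1 (fun x => f x * expi2 (dotp h x)).
Proof.
move=> [f1 f2].
have i1 := integrable_trig f1 (trig_cos0 h); have i2 := integrable_trig f2 (trig_cos0 h).
have j1 := integrable_trig f1 (trig_sin0 h); have j2 := integrable_trig f2 (trig_sin0 h).
split.
- have := integrable_lin 1 (-1) i1 j2; congr (mu.-integrable).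
  apply/funext => t; rewrite /comp; case: (f _) => u v; rewrite ReM/= mul1r.
  by rewrite mulN1r mulNr.
- have := integrable_lin 1 1 i2 j1; congr (mu.-integrable).
  by apply/funext => t; rewrite /comp; case: (f _) => u v; rewrite ImM/= !mul1r.
Qed.

Lemma torus_L1_cst1 : torus_L1 (fun _ : 'rV[R]_d => 1 : C).
Proof. by split; exact: finite_measure_integrable_cst. Qed.

Lemma torus_L1_exp h : torus_L1 (fun x : 'rV[R]_d => expi2 (dotp h x)).
Proof.
have := torus_L1_expi2 h torus_L1_cst1.
by congr torus_L1; apply/funext => x; rewrite mul1r.
Qed.

Lemma torus_int_exp h : torus_int (fun x : 'rV[R]_d => expi2 (dotp h x)) = (h == 0)%:R.
Proof.
have h0 : [forall i, h ord0 i == 0] = (h == 0).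
  apply/forallP/eqP => [H|-> i]; last by rewrite mxE.
  by apply/rowP => i; rewrite mxE; exact/eqP.
have H a : Rintegral mu setT (fun t => cos2 (a + dotp h (tuple_row t))) =
    if h == 0 then cos2 a else 0.
  rewrite /Rintegral; under eq_integral do rewrite dotp_tuple_row.
  by rewrite integral_cos2_phase h0.
rewrite /torus_int /=.
have -> : Rintegral mu setT (fun t => cos (2 * pi * dotp h (tuple_row t))) = (h == 0)%:R.
  have := H 0; under eq_Rintegral do rewrite add0r.
  by move=> ->; rewrite /cos2 mulr0 cos0; case: eqP.
have -> : Rintegral mu setT (fun t => sin (2 * pi * dotp h (tuple_row t))) = 0.
  have := H (- 4^-1); under eq_Rintegral do rewrite addrC -sin2E.
  by move=> ->; rewrite -[X in cos2 X]add0r -sin2E /sin2 mulr0 sin0; case: eqP.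
by case: eqP.
Qed.

Lemma torus_int0 : torus_int (fun _ : 'rV[R]_d => 0 : C) = 0.
Proof. by rewrite /torus_int /= /Rintegral integral0. Qed.

Lemma torus_L1_0 : torus_L1 (fun _ : 'rV[R]_d => 0 : C).
Proof. by split; exact: finite_measure_integrable_cst. Qed.

Lemma torus_L1_trig_sum (F : seq 'rV[int]_d) (c : 'rV[int]_d -> C) :
  torus_L1 (trig_sum F c).
Proof.
elim: F => [|k F IH].
  by have := torus_L1_0; congr torus_L1; apply/funext => x; rewrite /trig_sum big_nil.
have := torus_L1D (torus_L1Z (c k) (torus_L1_exp k)) IH.
by congr torus_L1; apply/funext => x; rewrite /trig_sum big_cons.
Qed.

Lemma fourier_coef_dotp f h :
  fourier_coef f h = torus_int (fun x => f x * expi2 (dotp (- h) x)).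
Proof. by congr torus_int; apply/funext => x; rewrite dotpN. Qed.

Lemma fourier_coefD f g h : torus_L1 f -> torus_L1 g ->
  fourier_coef (fun x => f x + g x) h = fourier_coef f h + fourier_coef g h.
Proof.
move=> f1 g1; rewrite !fourier_coef_dotp -torus_intD; try exact: torus_L1_expi2.
by congr torus_int; apply/funext => x; rewrite mulrDl.
Qed.

Lemma fourier_coefZ (c : C) f h : torus_L1 f ->
  fourier_coef (fun x => c * f x) h = c * fourier_coef f h.
Proof.
move=> f1; rewrite !fourier_coef_dotp -torus_intZ; last exact: torus_L1_expi2.
by congr torus_int; apply/funext => x; rewrite mulrA.
Qed.

Lemma fourier_coef_exp k h :
  fourier_coef (fun x : 'rV[R]_d => expi2 (dotp k x)) h = (k == h)%:R.
Proof.
rewrite fourier_coef_dotp -subr_eq0 -torus_int_exp; congr torus_int.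
by apply/funext => x; rewrite dotpD expi2D.
Qed.

Lemma fourier_coef_trig_sum (F : seq 'rV[int]_d) (c : 'rV[int]_d -> C) h :
  fourier_coef (trig_sum F c) h = \sum_(k <- F) c k * (k == h)%:R.
Proof.
elim: F => [|k F IH].
  rewrite big_nil -torus_int0; congr torus_int; apply/funext => x.
  by rewrite /trig_sum big_nil mul0r.
rewrite big_cons -IH -fourier_coef_exp -fourier_coefZ; last exact: torus_L1_exp.
rewrite -fourier_coefD; [|exact/torus_L1Z/torus_L1_exp|exact: torus_L1_trig_sum].
by congr fourier_coef; apply/funext => x; rewrite /trig_sum big_cons.
Qed.

(** [2 cos (2 pi (a + h.x))] is a combination of the exponentials of
    frequencies [h] and [- h]. *)
Lemma fourier_coef_cos f h a : torus_L1 f ->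
  fourier_coef f h = 0 -> fourier_coef f (- h) = 0 ->
  Rintegral mu setT (fun t => complex.Re (f (tuple_row t)) * cos2 (a + dotp h (tuple_row t))) = 0 /\
  Rintegral mu setT (fun t => complex.Im (f (tuple_row t)) * cos2 (a + dotp h (tuple_row t))) = 0.
Proof.
move=> f1; rewrite !fourier_coef_dotp opprK => h1 h2.
have i1 := torus_L1_expi2 (- h) f1; have i2 := torus_L1_expi2 h f1.
have : torus_int (fun x => expi2 (- a) * (f x * expi2 (dotp (- h) x)) +
                           expi2 a * (f x * expi2 (dotp h x))) = 0.
  by rewrite torus_intD ?torus_intZ ?h1 ?h2 ?mulr0 ?addr0//; exact: torus_L1Z.
have -> : (fun x => expi2 (- a) * (f x * expi2 (dotp (- h) x)) +
                  expi2 a * (f x * expi2 (dotp h x))) =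
     (fun x => (2 * complex.Re (f x) * cos2 (a + dotp h x)) +i*
               (2 * complex.Im (f x) * cos2 (a + dotp h x)))%C.
  (* The two terms are [f x] times an exponential and times its conjugate. *)
  apply/funext => x; rewrite !(mulrCA (expi2 _)) -!expi2D -mulrDr dotpN -opprD.
  move: (a + _) (f x) => y [u v]; rewrite /expi2 -!/(cos2 _) -!/(sin2 _) cos2N sin2N.
  move: (cos2 y) (sin2 y) => p q; simpc; congr (_ +i* _)%C => /=; lra.
case: f1 => f11 f12 [/= e1 e2]; split.
- move: e1; under eq_Rintegral do rewrite -mulrA.
  rewrite RintegralZl//; last exact: (integrable_trig f11 (trig_cos_dotp a h)).
  by move/eqP; rewrite mulf_eq0 pnatr_eq0 => /eqP.
- move: e2; under eq_Rintegral do rewrite -mulrA.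
  rewrite RintegralZl//; last exact: (integrable_trig f12 (trig_cos_dotp a h)).
  by move/eqP; rewrite mulf_eq0 pnatr_eq0 => /eqP.
Qed.

End FourierCoef.

(** * Absolutely convergent Fourier series *)

(** Besides convergence, the rate is inherited by the limit. *)
Lemma cvg_of_dist (R : realType) (a e : nat -> R) :
  e n @[n --> \oo] --> (0 : R) ->
  (forall n m, (n <= m)%N -> `|a m - a n| <= e n) ->
  cvgn a /\ forall n, `|limn a - a n| <= e n.
Proof.
move=> e0 ae.
have ca : cvgn a.
  apply: cauchy_cvg; apply: cauchy_exP => r r0.
  have [N _ hN] : \forall n \near \oo, e n < r by apply: (cvgr_lt _ e0).
  exists (a N); exists N => // m /= Nm; rewrite -ball_normE /ball_/= distrC.
  by apply: le_lt_trans (ae _ _ Nm) _; apply: hN => /=.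
split=> // n; rewrite ler_norml; apply/andP; split.
- rewrite lerBrDr; apply: limr_ge => //; exists n => // m /= nm.
  by have := ae _ _ nm; rewrite ler_norml => /andP[h _]; rewrite addrC; lra.
- rewrite lerBlDr; apply: limr_le => //; exists n => // m /= nm.
  by have := ae _ _ nm; rewrite ler_norml => /andP[_ h]; lra.
Qed.

Lemma big_fset_sub (V : nmodType) (K : choiceType) (F G : {fset K}) (f : K -> V) :
  (F `<=` G)%fset ->
  \sum_(k <- G) f k = \sum_(k <- F) f k + \sum_(k <- (G `\` F)%fset) f k.
Proof.
move=> FG; rewrite (big_fsetID _ (mem F))/=.
congr (_ + _); apply: congr_big => //; congr enum_fset; apply/fsetP => k.
  by rewrite !inE/=; case: (boolP (k \in F)) => kF; rewrite ?andbF// (fsubsetP FG).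
by rewrite !inE/= andbC.
Qed.

Section EpsilonContinuity.
Context {R : realType} (d : nat).
Local Notation C := (R[i]).
Implicit Types (f g : 'rV[R]_d -> C).

(** Continuity for the real-valued modulus [cmod]; the norm of [R[i]] itself
    takes its values in [R[i]]. *)
Definition cmod_continuous f :=
  forall x (e : R), 0 < e -> \forall y \near x, cmod (f x - f y) < e.

Lemma cmod_continuousP f :
  cmod_continuous f <-> continuous (f : 'rV[R]_d -> (R[i])^o).
Proof.
split=> [h x|h x e e0].
  apply/(@cvgrPdist_lt _ _ _ _ (nbhs_filter x)) => e e0.
  have eE : e = (complex.Re e)%:C%C.
    by case: e e0 => a b; rewrite ltcE/= => /andP[/eqP -> _].
  have e0' : 0 < complex.Re e by move: e0; rewrite ltcE => /andP[].
  by apply: (@filterS _ _ (nbhs_filter x)) (h x _ e0') => y hy; rewrite eE ltcR.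
have e0' : 0 < e%:C%C :> (R[i])^o by rewrite ltcR.
have := h x => /cvgrPdist_lt /(_ _ e0').
apply: (@filterS _ _ (nbhs_filter x)) => y.
by rewrite ltcR.
Qed.

Lemma cmod_continuousD f g : cmod_continuous f -> cmod_continuous g ->
  cmod_continuous (fun x => f x + g x).
Proof.
move=> hf hg x e e0; have e2 : 0 < e / 2 by lra.
apply: (@filterS2 _ _ (nbhs_filter x)) (hf x _ e2) (hg x _ e2) => y h1 h2.
rewrite opprD addrACA (le_lt_trans (cmodD _ _))//; lra.
Qed.

Lemma cmod_continuousZ (c : C) f : cmod_continuous f -> cmod_continuous (fun x => c * f x).
Proof.
move=> hf x e e0.
have c0 := cmod_ge0 c.
have e2 : 0 < e / (cmod c + 1) by rewrite divr_gt0//; lra.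
apply: (@filterS _ _ (nbhs_filter x)) (hf x _ e2) => y; rewrite -mulrBr cmodM ltr_pdivlMr; last lra.
by have := cmod_ge0 (f x - f y); nra.
Qed.

Lemma cmod_continuous_cst (c : C) : cmod_continuous (fun=> c).
Proof. by move=> x e e0; apply: (@filterE _ _ (nbhs_filter x)) => y; rewrite subrr cmod0. Qed.

Lemma continuous_dotp (k : 'rV[int]_d) : continuous (fun x : 'rV[R]_d => dotp k x).
Proof.
rewrite /dotp; elim: (index_enum _) => [|i s IH] x.
  by under eq_fun do rewrite big_nil; exact: (@cvg_cst _ _ _ _ (nbhs_filter x)).
under eq_fun do rewrite big_cons.
apply: (@cvgD _ _ _ _ (nbhs_filter x)); last exact: IH.
apply: (@cvgM _ _ _ (nbhs_filter x)); last exact: coord_continuous.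
exact: (@cvg_cst _ _ _ _ (nbhs_filter x)).
Qed.

Lemma cmod_continuous_expi2 (k : 'rV[int]_d) :
  cmod_continuous (fun x => expi2 (dotp k x)).
Proof.
move=> x e e0; have e2 : 0 < e / 2 by lra.
have h1 : (fun y => cos2 (dotp k y)) @ x --> cos2 (dotp k x).
  by apply: continuous_comp; [exact: continuous_dotp|exact: continuous_cos2].
have h2 : (fun y => sin2 (dotp k y)) @ x --> sin2 (dotp k x).
  by apply: continuous_comp; [exact: continuous_dotp|exact: continuous_sin2].
move/cvgrPdist_lt : h1 => /(_ _ e2) h1; move/cvgrPdist_lt : h2 => /(_ _ e2) h2.
apply: (@filterS2 _ _ (nbhs_filter x)) h1 h2 => y h1 h2.
by rewrite (le_lt_trans (cmod_le _))//=; rewrite -!/(cos2 _) -!/(sin2 _); lra.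
Qed.

Lemma cmod_continuous_trig_sum (F : seq 'rV[int]_d) (c : 'rV[int]_d -> C) :
  cmod_continuous (trig_sum F c).
Proof.
elim: F => [|k F IH].
  have := cmod_continuous_cst 0; congr cmod_continuous.
  by apply/funext => x; rewrite /trig_sum big_nil.
have := cmod_continuousD (cmod_continuousZ (c k) (@cmod_continuous_expi2 k)) IH.
by congr cmod_continuous; apply/funext => x; rewrite /trig_sum big_cons.
Qed.

Lemma cmod_continuous_lim (g : nat -> 'rV[R]_d -> C) f (e : nat -> R) :
  (forall n, cmod_continuous (g n)) -> e n @[n --> \oo] --> (0 : R) ->
  (forall n x, cmod (f x - g n x) <= e n) -> cmod_continuous f.
Proof.
move=> gc e0 fg x r r0; have r3 : 0 < r / 3 by lra.
have [N _ hN] : \forall n \near \oo, e n < r / 3 by apply: (cvgr_lt _ e0).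
have {}hN := hN N (leqnn N).
apply: (@filterS _ _ (nbhs_filter x)) (gc N x _ r3) => y hy.
have h1 := fg N x; have h2 := fg N y.
have -> : f x - f y = (f x - g N x) + ((g N x - g N y) + (g N y - f y)).
  by rewrite addrA subrKA addrA subrK.
apply: le_lt_trans (cmodD _ _) _; have := cmodD (g N x - g N y) (g N y - f y).
by rewrite (cmodB (g N y)); lra.
Qed.

End EpsilonContinuity.

Section FourierSeries.
Context {R : realType} (d : nat).
Local Notation RR := (measurableTypeR R).
Local Notation C := (R[i]).
Local Notation T := (d.-tuple RR).
Local Notation mu := (torus_measure R d).
Variables (c : 'rV[int]_d -> C) (A : nat -> {fset 'rV[int]_d}) (K : R).
Hypothesis A_mono : forall m n, (m <= n)%N -> (A m `<=` A n)%fset.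
Hypothesis A_exhaust : forall k, exists n, k \in A n.
Hypothesis c_summable : forall F : {fset 'rV[int]_d}, \sum_(k <- F) cmod (c k) <= K.

Let mass n := \sum_(k <- A n) cmod (c k).

(** The moduli of the terms outside [A n] add up to at most half of this; the
    factor [2] comes from treating real and imaginary parts separately. *)
Definition series_rem n : R := 2 * (limn mass - mass n).

Let mass_split m n : (n <= m)%N ->
  mass m = mass n + \sum_(k <- (A m `\` A n)%fset) cmod (c k).
Proof.
by move=> nm; rewrite /mass (big_fset_sub _ (A_mono nm)).
Qed.

Let mass_nd : nondecreasing_seq mass.
Proof.
move=> n m nm; rewrite (mass_split nm) lerDl sumr_ge0// => k _.
exact: cmod_ge0.
Qed.

Let mass_cvg : cvgn mass.
Proof.
by apply: nondecreasing_is_cvgn => //; exists K => _ [n _ <-]; exact: c_summable.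
Qed.

Lemma series_rem_cvg : series_rem n @[n --> \oo] --> (0 : R).
Proof.
rewrite -(mulr0 (2 : R)) -(subrr (limn mass)).
by apply: cvgM; [exact: cvg_cst|apply: cvgB => //; exact: cvg_cst].
Qed.

Lemma trig_sum_dist n m x : (n <= m)%N ->
  cmod (trig_sum (A m) c x - trig_sum (A n) c x) <= limn mass - mass n.
Proof.
move=> nm.
have -> : trig_sum (A m) c x - trig_sum (A n) c x = trig_sum (A m `\` A n)%fset c x.
  by rewrite /trig_sum (big_fset_sub _ (A_mono nm)) addrAC subrr add0r.
apply: (@le_trans _ _ (\sum_(k <- (A m `\` A n)%fset) cmod (c k))).
  rewrite (le_trans (cmod_sum _ _ _))//; apply: ler_sum => k _.
  by rewrite cmodM cmod_expi2 mulr1.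
have := nondecreasing_cvgn_le mass_nd mass_cvg m; rewrite (mass_split nm); lra.
Qed.

Definition series_lim (x : 'rV[R]_d) : C :=
  (limn (fun n => complex.Re (trig_sum (A n) c x)) +i*
   limn (fun n => complex.Im (trig_sum (A n) c x)))%C.

Let rem_half n : limn mass - mass n = series_rem n / 2.
Proof. by rewrite /series_rem; lra. Qed.

Let half_cvg : (fun n => limn mass - mass n) @ \oo --> (0 : R).
Proof. by rewrite -(subrr (limn mass)); apply: cvgB => //; exact: cvg_cst. Qed.

Let ReB (w v : C) : complex.Re (w - v) = complex.Re w - complex.Re v.
Proof. by case: w; case: v. Qed.
Let ImB (w v : C) : complex.Im (w - v) = complex.Im w - complex.Im v.
Proof. by case: w; case: v. Qed.

Let Re_dist x n m : (n <= m)%N ->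
  `|complex.Re (trig_sum (A m) c x) - complex.Re (trig_sum (A n) c x)| <=
  limn mass - mass n.
Proof.
by move=> nm; rewrite -ReB; apply: le_trans (Re_le_cmod _) (trig_sum_dist x nm).
Qed.

Let Im_dist x n m : (n <= m)%N ->
  `|complex.Im (trig_sum (A m) c x) - complex.Im (trig_sum (A n) c x)| <=
  limn mass - mass n.
Proof.
by move=> nm; rewrite -ImB; apply: le_trans (Im_le_cmod _) (trig_sum_dist x nm).
Qed.

Lemma series_lim_dist n x : cmod (series_lim x - trig_sum (A n) c x) <= series_rem n.
Proof.
rewrite (le_trans (cmod_le _))// ReB ImB /series_lim /=.
have [_ h1] := cvg_of_dist half_cvg (@Re_dist x).
have [_ h2] := cvg_of_dist half_cvg (@Im_dist x).
by have := h1 n; have := h2 n; rewrite rem_half; lra.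
Qed.

Lemma series_lim_continuous : cmod_continuous series_lim.
Proof.
apply: cmod_continuous_lim series_rem_cvg series_lim_dist => n.
exact: cmod_continuous_trig_sum.
Qed.

Lemma series_lim_periodic (x : 'rV[R]_d) (k : 'rV[int]_d) :
  series_lim (x + map_mx intr k) = series_lim x.
Proof.
rewrite /series_lim.
suff H n : trig_sum (A n) c (x + map_mx intr k) = trig_sum (A n) c x.
  by congr (_ +i* _)%C; congr (limn _); apply/funext => n; rewrite H.
apply: eq_bigr => h _; congr (_ * _).
have -> : dotp h (x + map_mx intr k) = dotp h x + (\sum_(i < d) h ord0 i * k ord0 i)%:~R.
  rewrite /dotp rmorph_sum/= -big_split; apply: eq_bigr => i _.
  by rewrite !mxE mulrDr intrM.
by rewrite expi2D expi2_int mulr1.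
Qed.

Lemma trig_Re_trig_sum (F : seq 'rV[int]_d) :
  trig_poly (fun t : T => complex.Re (trig_sum F c (tuple_row t))).
Proof.
elim: F => [|k F IH].
  by have := @trig_cst R d 0; congr trig_poly; apply/funext => t; rewrite /trig_sum big_nil.
have := trig_add (trig_sub (trig_scale (complex.Re (c k)) (@trig_cos0 R d k))
  (trig_scale (complex.Im (c k)) (@trig_sin0 R d k))) IH.
congr trig_poly; apply/funext => t; rewrite /trig_sum big_cons.
by case: (c k) => a b; case: (\sum_(_ <- _) _).
Qed.

Lemma trig_Im_trig_sum (F : seq 'rV[int]_d) :
  trig_poly (fun t : T => complex.Im (trig_sum F c (tuple_row t))).
Proof.
elim: F => [|k F IH].
  by have := @trig_cst R d 0; congr trig_poly; apply/funext => t; rewrite /trig_sum big_nil.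
have := trig_add (trig_add (trig_scale (complex.Re (c k)) (@trig_sin0 R d k))
  (trig_scale (complex.Im (c k)) (@trig_cos0 R d k))) IH.
congr trig_poly; apply/funext => t; rewrite /trig_sum big_cons.
by case: (c k) => a b; case: (\sum_(_ <- _) _).
Qed.

Lemma integrable_near (u v : T -> R) (e : R) : mu.-integrable setT (EFin \o v) ->
  measurable_fun setT (u : T -> RR) -> (forall t, `|u t - v t| <= e) ->
  mu.-integrable setT (EFin \o u).
Proof.
move=> vi um uv.
have vm : measurable_fun setT (v : T -> RR).
  by apply/measurable_EFinP; exact: measurable_int vi.
have wi : mu.-integrable setT (EFin \o (fun t => u t - v t)).
  apply: (@measurable_bounded_integrable _ _ _ mu (fun t => u t - v t)) => //.
  - by rewrite -ge0_fin_numE// fin_num_measure.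
  - exact: measurable_funB.
  - by exists e; split => [|M eM t _ /=]; [exact: num_real|rewrite (le_trans (uv t))// ltW].
have := integrableD measurableT wi vi; congr (mu.-integrable).
by apply/funext => t /=; rewrite -EFinD subrK.
Qed.

Lemma torus_L1_series_lim : torus_L1 series_lim.
Proof.
have tR := torus_L1_trig_sum (A 0%N) c; case: tR => r1 r2.
have P1 t n := le_trans (Re_le_cmod _) (series_lim_dist n (tuple_row t)).
have P2 t n := le_trans (Im_le_cmod _) (series_lim_dist n (tuple_row t)).
split.
- apply: (@integrable_near _ (fun t => complex.Re (trig_sum (A 0%N) c (tuple_row t))) (series_rem 0) r1).
    apply: (@measurable_fun_cvg _ _ _ _ (fun n t => complex.Re (trig_sum (A n) c (tuple_row t)))).
      by move=> n; exact: trig_measurable (trig_Re_trig_sum _).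
    by move=> t _; have [] := cvg_of_dist half_cvg (@Re_dist (tuple_row t)).
  by move=> t; rewrite -ReB.
- apply: (@integrable_near _ (fun t => complex.Im (trig_sum (A 0%N) c (tuple_row t))) (series_rem 0) r2).
    apply: (@measurable_fun_cvg _ _ _ _ (fun n t => complex.Im (trig_sum (A n) c (tuple_row t)))).
      by move=> n; exact: trig_measurable (trig_Im_trig_sum _).
    by move=> t _; have [] := cvg_of_dist half_cvg (@Im_dist (tuple_row t)).
  by move=> t; rewrite -ImB.
Qed.

End FourierSeries.

(** * The continuous representative *)

Section ContRep.
Context {R : realType} (d : nat).
Local Notation RR := (measurableTypeR R).
Local Notation C := (R[i]).
Local Notation T := (d.-tuple RR).
Local Notation mu := (torus_measure R d).

Lemma Rintegral_le_bound (u : T -> R) (e : R) : mu.-integrable setT (EFin \o u) ->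
  (forall t, `|u t| <= e) -> `|Rintegral mu setT u| <= e.
Proof.
move=> ui ue; apply: le_trans (le_normr_Rintegral measurableT ui) _.
have -> : e = Rintegral mu setT (fun=> e).
  by rewrite Rintegral_cst// [X in fine X](_ : _ = 1%E) ?mulr1//; exact: probability_setT.
apply: le_Rintegral => //; last by apply: finite_measure_integrable_cst.
have := integrable_abse ui; congr (mu.-integrable).
Qed.

Section AlmostEverywhere.
Variables (f : 'rV[R]_d -> C) (A : nat -> {fset 'rV[int]_d}) (K : R).
Hypothesis f_L1 : torus_L1 f.
Hypothesis A_mono : forall m n, (m <= n)%N -> (A m `<=` A n)%fset.
Hypothesis A_exhaust : forall k, exists n, k \in A n.
Let c := fourier_coef f.
Hypothesis c_summable : forall F : {fset 'rV[int]_d}, \sum_(k <- F) cmod (c k) <= K.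
Let G := series_lim c A.

Let g n (x : 'rV[R]_d) := f x + (-1) * trig_sum (A n) c x.

Let g_L1 n : torus_L1 (g n).
Proof. by apply: torus_L1D => //; exact/torus_L1Z/torus_L1_trig_sum. Qed.

Let g_coef n h : h \in A n -> fourier_coef (g n) h = 0.
Proof.
move=> hn; rewrite fourier_coefD//; last exact/torus_L1Z/torus_L1_trig_sum.
rewrite fourier_coefZ; last exact: torus_L1_trig_sum.
rewrite fourier_coef_trig_sum (big_fsetD1 h)//= eqxx mulr1 big_seq big1 ?addr0 ?mulN1r ?subrr//.
by move=> k; rewrite in_fsetD1 => /andP[/negbTE -> _]; rewrite mulr0.
Qed.

(** The Fourier coefficient at [h] of [f] minus a large partial sum vanishes, and
    the partial sums converge uniformly to [G]. Hence all Fourier coefficients of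
    [f - G] vanish, and uniqueness applies to its real and imaginary parts. *)
Lemma ae_series_lim : {ae mu, forall t, f (tuple_row t) = G (tuple_row t)}.
Proof.
have [f1 f2] := f_L1.
have [G1 G2] := torus_L1_series_lim A_mono c_summable.
(* [p] stands for the real part and for the imaginary part. *)
have key (p : C -> R) : (forall w v, p (w - v) = p w - p v) -> (forall w, `|p w| <= cmod w) ->
    mu.-integrable setT (EFin \o (fun t => p (f (tuple_row t)))) ->
    mu.-integrable setT (EFin \o (fun t => p (G (tuple_row t)))) ->
    (forall n, mu.-integrable setT (EFin \o (fun t => p (g n (tuple_row t))))) ->
    (forall n h a, h \in A n -> - h \in A n ->
      Rintegral mu setT (fun t => p (g n (tuple_row t)) * cos2 (a + dotp h (tuple_row t))) = 0) ->
    {ae mu, forall t, p (f (tuple_row t)) - p (G (tuple_row t)) = 0}.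
  move=> pB pc fi Gi gi gint.
  have ui : mu.-integrable setT (EFin \o (fun t => p (f (tuple_row t)) - p (G (tuple_row t)))).
    have := integrableB measurableT fi Gi; congr (mu.-integrable).
  apply: fourier_unique => // a k.
  pose h : 'rV[int]_d := \row_i k i.
  have phE t : phase k t = dotp h (tuple_row t).
    by rewrite dotp_tuple_row; apply: eq_bigr => i _; rewrite mxE.
  pose w t := (p (f (tuple_row t)) - p (G (tuple_row t))) * cos2 (a + dotp h (tuple_row t)).
  have wi : mu.-integrable setT (EFin \o w) := integrable_trig ui (trig_cos_dotp a h).
  under eq_integral do rewrite phE.
  suff w0 : Rintegral mu setT w = 0.
    by rewrite -[LHS](fineK (integrable_fin_num measurableT wi)) -/(Rintegral mu setT w) w0.
  have [N1 hN1] := A_exhaust h; have [N2 hN2] := A_exhaust (- h).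
  have wb n : (maxn N1 N2 <= n)%N -> `|Rintegral mu setT w| <= series_rem c A n.
    move=> Nn.
    have hn : h \in A n by apply: (fsubsetP (A_mono _)) hN1; rewrite (leq_trans _ Nn)// leq_maxl.
    have hn' : - h \in A n by apply: (fsubsetP (A_mono _)) hN2; rewrite (leq_trans _ Nn)// leq_maxr.
    pose w' t := p (g n (tuple_row t)) * cos2 (a + dotp h (tuple_row t)).
    have w'i : mu.-integrable setT (EFin \o w') := integrable_trig (gi n) (trig_cos_dotp a h).
    have -> : Rintegral mu setT w = Rintegral mu setT (fun t => w t - w' t).
      by rewrite RintegralB// [Rintegral mu setT w']gint// subr0.
    apply: Rintegral_le_bound.
      by have := integrableB measurableT wi w'i; congr (mu.-integrable).
    move=> t; rewrite /w /w' -mulrBl normrM -pB -pB.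
    have -> : f (tuple_row t) - G (tuple_row t) - g n (tuple_row t) =
        trig_sum (A n) c (tuple_row t) - G (tuple_row t).
      by rewrite /g mulN1r; move: (f _) (G _) (trig_sum _ _ _) => u v q; ring.
    rewrite (@le_trans _ _ (cmod (trig_sum (A n) c (tuple_row t) - G (tuple_row t)) * 1))//.
      by rewrite ler_pM// ?pc// cos_max.
    by rewrite mulr1 cmodB (series_lim_dist A_mono c_summable).
  apply/normr0_eq0/le_anti; rewrite normr_ge0 andbT.
  rewrite -(cvg_lim _ (series_rem_cvg A_mono c_summable))//.
  apply: limr_ge; first by apply/cvg_ex; exists 0; exact: (series_rem_cvg A_mono c_summable).
  by exists (maxn N1 N2).
have aeR := key (@complex.Re R) _ (@Re_le_cmod R) f1 G1.
have aeI := key (@complex.Im R) _ (@Im_le_cmod R) f2 G2.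
apply: (@filterS2 _ _ (ae_filter_ringOfSetsType mu)) (aeR _ _ _) (aeI _ _ _).
- by move=> t; case: (f _) => a b; case: (G _) => a' b' /= /eqP; rewrite subr_eq0 => /eqP ->
    /eqP; rewrite subr_eq0 => /eqP ->.
- by case=> ? ? [].
- by move=> n; have [] := g_L1 n.
- by move=> n h a h1 h2; have [] := fourier_coef_cos a (g_L1 n) (g_coef h1) (g_coef h2).
- by case=> ? ? [].
- by move=> n; have [] := g_L1 n.
- by move=> n h a h1 h2; have [] := fourier_coef_cos a (g_L1 n) (g_coef h1) (g_coef h2).
Qed.

Lemma series_lim_cont_rep : is_cont_rep f G.
Proof.
split.
- exact/cmod_continuousP/(series_lim_continuous A_mono c_summable).
- exact: series_lim_periodic.
- exact: ae_series_lim.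
Qed.

End AlmostEverywhere.

(** By continuity and periodicity, a disagreement would persist on a box of positive
    measure inside the unit cube. *)
Lemma cont_rep_unique (f g1 g2 : 'rV[R]_d -> C) :
  is_cont_rep f g1 -> is_cont_rep f g2 -> g1 = g2.
Proof.
move=> [c1 p1 a1] [c2 p2 a2].
have pos (x : 'rV[R]_d) : (forall i, 0 <= x ord0 i < 1) -> g1 x = g2 x.
  move=> x01; apply: contrapT => x12.
  have w0 : 0 < cmod (g1 x - g2 x).
    rewrite lt_neqAle cmod_ge0 andbT eq_sym; apply/eqP => /cmod_eq0/eqP.
    by rewrite subr_eq0 => /eqP.
  have h1 : cmod_continuous (fun x => g1 x + (-1) * g2 x).
    by apply: cmod_continuousD; [exact/cmod_continuousP|exact/cmod_continuousZ/cmod_continuousP].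
  have := h1 x _ w0 => /nbhs_ballP [r /= r0 hr].
  have ne y : ball x r y -> g1 y <> g2 y.
    move=> /hr /=; rewrite !mulN1r => + E; rewrite E subrr subr0 => lt.
    by rewrite ltxx in lt.
  pose B (i : 'I_d) : set RR := `]x ord0 i, Num.min (x ord0 i + r) 1[%classic.
  have B0 : (0 < mu [set t | forall i, B i (tnth t i)])%E.
    rewrite torus_box; last by move=> i; exact: measurable_itv.
    elim/big_ind: _ => // [u v|i _]; first exact: mule_gt0.
    have /andP[x0 x1] := x01 i.
    have lt : x ord0 i < Num.min (x ord0 i + r) 1 by rewrite lt_min x1 andbT; lra.
    by rewrite leb01_itv// ?lte_fin ?subr_gt0// ge_min lexx orbT.
  have [N [mN N0 hN]] := @filterI _ _ (ae_filter_ringOfSetsType mu) _ _ a1 a2.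
  have sub : [set t | forall i, B i (tnth t i)] `<=` N.
    move=> t tB; apply: hN => /= -[e1 e2]; apply: (ne (tuple_row t)); last by rewrite -e1.
    split=> // i j; rewrite ord1 mxE.
    have := tB j; rewrite /B /= in_itv/= lt_min => /andP[l1 /andP[l2 _]].
    by rewrite -ball_normE /ball_ /= distrC ger0_norm; lra.
  have mB : measurable [set t : T | forall i, B i (tnth t i)].
    rewrite (_ : [set t | _] = \bigcap_(i in setT) ((fun t : T => tnth t i) @^-1` (B i))).
      apply: fin_bigcap_measurable => // i _.
      by rewrite -[X in measurable X]setTI; apply: measurable_tnth => //; exact: measurable_itv.
    by apply/seteqP; split => [t h i _|t h i]; [exact: h|exact: (h i I)].
  have le0 := le_measure mu (mem_set mB) (mem_set mN) sub.
  have le1 : (mu N <= 0)%E by rewrite N0.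
  by have := lt_le_trans B0 (le_trans le0 le1); rewrite ltxx.
apply/funext => x.
pose k : 'rV[int]_d := \row_i - Num.floor (x ord0 i).
rewrite -(p1 x k) -(p2 x k); apply: pos => i; rewrite !mxE intrN.
by have := floor_itv (x ord0 i); rewrite intrD => /andP[h1 h2]; apply/andP; split; lra.
Qed.

Lemma cont_repE (f g : 'rV[R]_d -> C) : is_cont_rep f g -> cont_rep f = g.
Proof.
move=> fg; apply: (@cont_rep_unique f) => //.
by rewrite /cont_rep; apply: (@xgetPex _ f [set g | is_cont_rep f g]); exists g.
Qed.

End ContRep.

(** * The error bound *)

Section SamplingStability.
Context {R : realType} (d : nat).
Local Notation C := (R[i]).
Implicit Types (f g : 'rV[R]_d -> C).

Lemma lattice_coef_bound f z (M : nat) h (e : R) : (0 < M)%N ->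
  (forall x, cmod (f x) <= e) -> cmod (lattice_coef f z M h) <= e.
Proof.
move=> M0 fe; rewrite /lattice_coef cmodM.
have MR : 0 < M%:R :> R by rewrite ltr0n.
have -> : cmod (M%:R^-1 : C) = M%:R^-1.
  have -> : (M%:R^-1 : C) = (M%:R^-1)%:C%C by rewrite fmorphV rmorph_nat.
  by rewrite /cmod /= expr0n addr0 sqrtr_sqr ger0_norm// invr_ge0 ltW.
rewrite mulrC ler_pdivrMr// (le_trans (cmod_sum _ _ _))//.
have -> : e * M%:R = \sum_(j < M) e by rewrite sumr_const card_ord mulr_natr.
apply: ler_sum => j _.
by rewrite cmodM cmod_expi2 mulr1.
Qed.

Lemma sampling_op_stable f (I : {fset 'rV[int]_d}) L (z : nat -> 'rV[int]_d) M (e : R) x :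
  (forall l, (l < L)%N -> (0 < M l)%N) -> (forall y, cmod (f y) <= e) ->
  cmod (sampling_op I L z M f x) <= (\sum_(l < L) \sum_(h <- level I z M l) 1) * e.
Proof.
move=> M0 fe; rewrite /sampling_op (le_trans (cmod_sum _ _ _))// mulr_suml.
apply: ler_sum => l _; rewrite (le_trans (cmod_sum _ _ _))// mulr_suml.
apply: ler_sum => h _; rewrite cmodM cmod_expi2 mulr1 mul1r.
by apply: lattice_coef_bound => //; exact: M0.
Qed.

Lemma sampling_opB f g (I : {fset 'rV[int]_d}) L (z : nat -> 'rV[int]_d) M x :
  sampling_op I L z M (fun y => f y - g y) x =
  sampling_op I L z M f x - sampling_op I L z M g x.
Proof.
rewrite /sampling_op -sumrB; apply: eq_bigr => l _.
rewrite -sumrB; apply: eq_bigr => h _; rewrite -mulrBl; congr (_ * _).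
rewrite /lattice_coef -mulrBr -sumrB; congr (_ * _).
by apply: eq_bigr => j _; rewrite mulrBl.
Qed.

End SamplingStability.

Section Error.
Context {R : realType} (d : nat).
Local Notation C := (R[i]).
Variables (alpha : R) (gamma : 'I_d -> R).
Hypothesis gamma_le1 : forall j, gamma j <= 1.
Hypothesis gamma_gt0 : forall j, 0 < gamma j.
Hypothesis alpha_gt1 : 1 < alpha.
Local Notation r := (korobov_weight alpha gamma).

Let r_gt0 := weight_gt0 alpha gamma.

Lemma korobov_norm_sum (f : 'rV[R]_d -> C) : (korobov_norm alpha gamma f <= 1)%E ->
  forall F : {fset 'rV[int]_d}, \sum_(k <- F) r k * cmod (fourier_coef f k) ^+ 2 <= 1.
Proof.
rewrite /korobov_norm; set S := esum _ _ => S1 F.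
have S0 : (0 <= S)%E.
  apply: esum_ge0 => k _; rewrite lee_fin mulr_ge0 ?exprn_ge0 ?cmod_ge0//.
  exact/ltW/r_gt0.
have {}S1 : (S <= 1)%E.
  have -> : S = ((S `^ 2^-1) `^ 2)%E by rewrite -poweRrM mulVf// poweRe1.
  rewrite -(poweR1r 2).
  by apply: gt0_ler_poweR; rewrite ?in_itv/= ?leey ?andbT ?poweR_ge0.
rewrite -lee_fin (le_trans _ S1)//; apply: esum_ge; exists [set` F].
  by split => //; exact: finite_fset.
by rewrite -fsbig_seq ?fset_uniq// sumEFin.
Qed.

Section Tail.
Variables (N s : R).
Hypothesis s_gt1 : 1 < s.
Hypothesis s_lt : s < alpha.
Local Notation I := (korobov_index alpha gamma N).
Hypothesis N_ge1 : 1 <= N.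

Let at1 : 1 < alpha * s^-1.
Proof. by rewrite ltr_pdivlMr ?mul1r// (lt_trans ltr01). Qed.

Lemma card_index_gt0 : (0 < #|` I|)%N.
Proof.
rewrite cardfs_gt0; apply/fset0Pn; exists 0.
by rewrite mem_korobov_index// weight0.
Qed.

(** The square root of the bound of [weight_tail_sum] for the weights of the
    frequencies outside [I]. *)
Definition tail_const : R :=
  zeta_prod alpha gamma s^-1 * Num.sqrt (s - 1)^-1 * #|` I|%:R `^ (- ((s - 1) / 2)).

Let base_gt0 j : 0 < 1 + 2 * zeta (alpha * s^-1) * gamma j `^ s^-1.
Proof.
have := mulr_ge0 (zeta_ge0 at1) (powR_ge0 (gamma j) s^-1).
by rewrite -mulrA; lra.
Qed.

Lemma zeta_prod_gt0 : 0 < zeta_prod alpha gamma s^-1.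
Proof. by apply: prodr_gt0 => j _; rewrite powR_gt0. Qed.

Lemma tail_const_gt0 : 0 < tail_const.
Proof.
rewrite /tail_const !mulr_gt0 ?zeta_prod_gt0 ?sqrtr_gt0 ?invr_gt0 ?powR_gt0 ?ltr0n ?card_index_gt0//.
by rewrite subr_gt0.
Qed.

Lemma weight_tail_sqr (J : {fset 'rV[int]_d}) : [disjoint J & I]%fset ->
  \sum_(k <- J) (r k)^-1 <= tail_const ^+ 2.
Proof.
move=> JI.
have s0 : 0 < s := lt_trans ltr01 s_gt1.
set P := \prod_(j < d) (1 + 2 * zeta (alpha * s^-1) * gamma j `^ s^-1).
have P0 : 0 <= P by apply: prodr_ge0 => j _; exact/ltW/base_gt0.
have H := @weight_tail_sum R _ r I N P s s_gt1 r_gt0.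
apply: le_trans (H _ _ _ J _) _.
- by move=> k; rewrite mem_korobov_index.
- by move=> F; apply: weight_sum; rewrite ?invr_gt0.
- exact: card_index_gt0.
- move=> k kJ; have := fdisjointP JI _ kJ.
  by rewrite mem_korobov_index// -ltNge.
rewrite /tail_const !exprMn.
have -> : zeta_prod alpha gamma s^-1 ^+ 2 = P `^ s.
  have -> : zeta_prod alpha gamma s^-1 = P `^ (2 * s^-1)^-1.
    by rewrite powR_prod// => j; exact/ltW/base_gt0.
  rewrite -powR_mulrn ?powR_ge0// -powRrM; congr (_ `^ _); field; rewrite gt_eqF//.
have -> : (#|` I|%:R `^ (- ((s - 1) / 2))) ^+ 2 = #|` I|%:R `^ (1 - s) :> R.
  rewrite -powR_mulrn ?powR_ge0// -powRrM; congr (_ `^ _); lra.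
by rewrite sqr_sqrtr ?invr_ge0 ?subr_ge0 ?(ltW s_gt1)// -mulrA [X in _ * X]mulrC.
Qed.

(** The Cauchy-Schwarz inequality between [r ^ (- 1 / 2)] and [r ^ (1 / 2) |c|], whose
    proof is that of [2 x y <= x ^ 2 / B + B y ^ 2] for [B] the bound itself. *)
Lemma coef_tail (c : 'rV[int]_d -> C) :
  (forall F : {fset 'rV[int]_d}, \sum_(k <- F) r k * cmod (c k) ^+ 2 <= 1) ->
  forall J : {fset 'rV[int]_d}, [disjoint J & I]%fset ->
  \sum_(k <- J) cmod (c k) <= tail_const.
Proof.
move=> c1 J JI; have B0 := tail_const_gt0; have := weight_tail_sqr JI.
have := c1 J; set B := tail_const in B0 * => h1 h2.
have h3 : \sum_(k <- J) cmod (c k) <=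
    \sum_(k <- J) (B^-1 / 2 * (r k)^-1 + B / 2 * (r k * cmod (c k) ^+ 2)).
  apply: ler_sum => k _; have k0 := r_gt0 k; have a0 := cmod_ge0 (c k).
  move: (r k) (cmod (c k)) k0 a0 => w a w0 a0.
  have -> : B^-1 / 2 * w^-1 + B / 2 * (w * a ^+ 2) = a + (B * w * a - 1) ^+ 2 / (2 * B * w).
    by field; rewrite !gt_eqF.
  have Bw : 0 <= 2 * B * w by apply: mulr_ge0; [apply: mulr_ge0 => //|]; exact: ltW.
  by rewrite lerDl divr_ge0 ?sqr_ge0.
apply: le_trans h3 _; rewrite big_split/= -!mulr_sumr.
rewrite [leRHS](_ : B = B^-1 / 2 * B ^+ 2 + B / 2 * 1); last by field; rewrite gt_eqF.
have B1 := ltW B0; by apply: lerD; apply: ler_wpM2l => //; rewrite divr_ge0 ?invr_ge0.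
Qed.

Lemma coef_summable (c : 'rV[int]_d -> C) :
  (forall F : {fset 'rV[int]_d}, \sum_(k <- F) r k * cmod (c k) ^+ 2 <= 1) ->
  forall F : {fset 'rV[int]_d},
  \sum_(k <- F) cmod (c k) <= \sum_(k <- I) cmod (c k) + tail_const.
Proof.
move=> c1 F; rewrite (big_fset_sub (F := (F `&` I)%fset)) ?fsubsetIl//.
apply: lerD.
  apply: ler_sum_subseq; [exact: fset_uniq| |by move=> k; exact: cmod_ge0].
  by move=> k; rewrite in_fsetI => /andP[].
apply: coef_tail => //; apply/fdisjointP => k.
by rewrite !inE => /andP[+ kF]; rewrite kF.
Qed.

Variables (L : nat) (z : nat -> 'rV[int]_d) (M : nat -> nat).
Hypothesis M_gt0 : forall l, (l < L)%N -> (0 < M l)%N.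
Hypothesis I_levels : I = (\bigcup_(l <- iota 0 L) level I z M l)%fset.

(** The bound for partial sums of the Fourier series passes to the limit [G], the
    operator being continuous for uniform convergence. *)
Lemma torus_Linfty_error (f : 'rV[R]_d -> C) :
  korobov_space alpha gamma f -> (korobov_norm alpha gamma f <= 1)%E ->
  (torus_Linfty (fun x => f x - sampling_op I L z M (cont_rep f) x)%R <=
   ((1 + L%:R) * tail_const)%:E)%E.
Proof.
move=> [f_L1 _] f1; have c1 := korobov_norm_sum f1.
have c_sum := coef_summable c1.
set c := fourier_coef f in c1 c_sum.
(* The frequency sets are finite, increasing and exhaust all frequencies, so the
   partial sums of the series may run over them. *)
pose A n := korobov_index alpha gamma n%:R.
have A_mono m n : (m <= n)%N -> (A m `<=` A n)%fset.
  move=> mn; apply/fsubsetP => k; rewrite !mem_korobov_index// => /le_trans; apply.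
  by rewrite ler_nat.
have A_ge k n : r k <= n%:R -> k \in A n by rewrite mem_korobov_index.
have A_exhaust k : exists n, k \in A n.
  exists (Num.truncn (r k)).+1; apply/A_ge/ltW; exact: truncnS_gt.
have GP := series_lim_cont_rep f_L1 A_mono A_exhaust c_sum.
rewrite (cont_repE GP); set G := series_lim _ _ in GP *.
have Gbound x : cmod (G x - sampling_op I L z M G x) <= (1 + L%:R) * tail_const.
  set W : R := \sum_(l < L) \sum_(h <- level I z M l) 1.
  have rc := series_rem_cvg A_mono c_sum.
  have step n : N <= n%:R -> cmod (G x - sampling_op I L z M G x) <=
      (1 + L%:R) * tail_const + (1 + W) * series_rem c A n.
    move=> Nn; pose g := trig_sum (A n) c.
    have -> : G x - sampling_op I L z M G x =
        (g x - sampling_op I L z M g x) +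
        ((G x - g x) - sampling_op I L z M (fun y => G y - g y) x).
      rewrite sampling_opB; move: (G x) (g x) (sampling_op _ _ _ _ _ _) (sampling_op _ _ _ _ _ _).
      by move=> u v p q; ring.
    rewrite (le_trans (cmodD _ _))// lerD//.
      rewrite (le_trans (sampling_error_bound M_gt0 I_levels _ _ _))//.
      rewrite ler_wpM2l//.
      apply: coef_tail => //; apply/fdisjointP => k.
      by rewrite !inE => /andP[].
    rewrite (le_trans (cmodD _ _))// cmodN mulrDl mul1r lerD//.
      exact: (series_lim_dist A_mono c_sum).
    apply: sampling_op_stable => // y.
    exact: (series_lim_dist A_mono c_sum).
  have cv : (1 + L%:R) * tail_const + (1 + W) * series_rem c A n @[n --> \oo] -->
      (1 + L%:R) * tail_const.
    rewrite -[X in _ --> X]addr0 -(mulr0 (1 + W)).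
    apply: cvgD; first exact: cvg_cst.
    by apply: cvgM => //; exact: cvg_cst.
  rewrite -(cvg_lim _ cv)//; apply: limr_ge; first by apply/cvg_ex; eexists; exact: cv.
  exists (Num.truncn N).+1 => // n /= Nn; apply: step.
  apply: le_trans (_ : (Num.truncn N).+1%:R <= _); last by rewrite ler_nat.
  by apply/ltW; exact: truncnS_gt.
rewrite /torus_Linfty Lnorm.unlock /=; case: ifP => _; last first.
  by rewrite lee_fin mulr_ge0 ?addr_ge0// ltW// tail_const_gt0.
apply/ess_supP; have [_ _] := GP.
apply: (@filterS _ _ (ae_filter_ringOfSetsType (torus_measure R d))) => t /= ->.
by rewrite lee_fin ger0_norm ?cmod_ge0.
Qed.

End Tail.
End Error.

Theorem corollary4p5 (R : realType) (d : nat) (alpha : R) (gamma : 'I_d -> R)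
    (alpha' t : R)
    (d_ge1 : (1 <= d)%N)
    (alpha_gt1 : 1 < alpha)
    (gamma_le1 : forall j : 'I_d, gamma j <= 1)
    (gamma_mono : forall i j : 'I_d, (i <= j)%N -> gamma j <= gamma i)
    (gamma_gt0 : forall j : 'I_d, 0 < gamma j)
    (alpha'_gt1 : 1 < alpha') (alpha'_le : alpha' <= alpha)
    (t_range : 0 < t < (alpha' - 1) / 2) :
  exists delta tau : R,
    [/\ delta = delta_const alpha' t /\ tau = (alpha' - delta)^-1,
        0 < delta < 1,
        alpha'^-1 < tau < 1 /\
          [set x | alpha'^-1 < x < 1] `<=` [set x | alpha^-1 < x < 1],
        c_const alpha gamma delta tau <
          4 * 3 `^ (alpha' - 1) * delta `^ (- ((alpha' + 1) / 2))
          * Num.sqrt (2 / (alpha' - 1)) * zeta_prod alpha gamma tau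
      & forall (N : R) (L : nat) (z : nat -> 'rV[int]_d) (M : nat -> nat),
          let I := korobov_index alpha gamma N in
          let Lam : set 'rV[R]_d := multiple_lattice L z M in
          let card_I : R := (#|` I|)%:R in
          let card_Lam : R := (#|` fset_set Lam|)%:R in
          1 <= N -> (1 <= L)%N -> (forall l, (l < L)%N -> (1 <= M l)%N) ->
          I = (\bigcup_(l <- iota 0 L) level I z M l)%fset ->
          L%:R <= Num.max (3 * ln card_I) 1 ->
          (forall l, (l < L)%N -> M l = M 0%N) ->
          (M 0%N)%:R <= 3 * card_I ->
          2 * card_I < card_Lam ->
          card_Lam < 9 * card_I * Num.max (ln card_I) 1 ->
          (ereal_sup
             [set torus_Linfty (fun x => f x - sampling_op I L z M (cont_rep f) x)%R
               | f in [set f | korobov_space alpha gamma f /\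
                               (korobov_norm alpha gamma f <= 1)%E]]
           < (c_const alpha gamma delta tau * card_Lam `^ (- t))%R%:E)%E].
Proof.
have [d01 da dt] := delta_constP alpha'_gt1 t_range.
set e := delta_const alpha' t in d01 da dt.
have [e0 e1] := andP d01.
pose s := alpha' - e.
have s1 : 1 < s by rewrite /s; lra.
have s0 : 0 < s by lra.
have sa' : s < alpha' by rewrite /s; lra.
have sa : s < alpha by exact: lt_le_trans alpha'_le.
exists e, s^-1.
have Z0 := zeta_prod_gt0 gamma s1 sa.
split => //.
- split.
    by rewrite invf_lt1// s1 andbT ltf_pV2 ?posrE// (lt_trans s0).
  move=> x /= /andP[x1 x2]; apply/andP; split => //.
  by apply: le_lt_trans x1; rewrite lef_pV2 ?posrE//; lra.
- exact: c_const_lt.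
move=> N L z M I Lam card_I card_Lam N1 L1 M1 IE LI _ _ LamI LamI'.
have I0 : (0 < #|` I|)%N by exact: card_index_gt0.
have cI1 : 1 <= card_I by rewrite ler1n.
have Lam0 : 0 < card_Lam by lra.
have rate := rate_lt (erefl e) (erefl s) alpha'_gt1 t_range cI1 Lam0 LamI' LI.
apply: (@le_lt_trans _ _ ((1 + L%:R) * tail_const alpha gamma N s)%:E).
  apply: ge_ereal_sup => _ [f [fK f1] <-].
  exact: (torus_Linfty_error gamma_le1 gamma_gt0 alpha_gt1 s1 sa N1 M1 IE fK f1).
rewrite lte_fin /tail_const /c_const invrK.
have -> : s^-1 / (1 - s^-1) = (s - 1)^-1 by field; rewrite ?gt_eqF//; lra.
have -> : (1 + s^-1) / (2 * s^-1) = (1 + s) / 2 by field; rewrite gt_eqF.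
rewrite -/card_I; set Q := Num.sqrt _; set Z := zeta_prod _ _ _ in Z0 *.
have Q0 : 0 < Q by rewrite sqrtr_gt0 invr_gt0; lra.
have ZQ : 0 < Z * Q by rewrite mulr_gt0.
have rateZQ := rate; rewrite -(ltr_pM2r ZQ) in rateZQ; move: rateZQ.
move: (card_I `^ _) (3 `^ _) (e `^ _) (card_Lam `^ _) => a b g m.
by clearbody Q Z; congr (_ < _); ring.
Qed.
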